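(* Suppose $X$ is a compact $3$-manifold with boundary, no component of which is a $2$-sphere, and $\mathcal{T}^*$ is an ideal triangulation of the interior of $X$. If $\Lambda$ is a collection of frames in the vertex-linking surfaces of $\mathcal{T}^*$, one from each vertex-linking surface of $\mathcal{T}^*$, then an inflation triangulation $\mathcal{T}_\Lambda$ of $\mathcal{T}^*$ has $$\mathrm{card}(\mathcal{T}^* )+\mathcal{C}(\Lambda)$$ tetrahedra, where $\mathrm{card}(\mathcal{T}^* )$ is the number of tetrahedra in $\mathcal{T}^*$ and $\mathcal{C}(\Lambda)$ is the complexity of $\Lambda$.
   Context: **Triangulations.** A triangulation is a finite disjoint collection of tetrahedra with a family of affine face pairings (each face is in at most one pairing; two faces of one tetrahedron may be paired), such that the quotient map is injective on the interior of every simplex of every dimension. It is an ideal triangulation of the interior of a compact $3$-manifold $X$ if the quotient with its vertices (the ideal vertices) removed is homeomorphic to the interior of $X$. The vertex-linking surface of a vertex consists of one normal triangle for each tetrahedron corner at that vertex. It has an induced triangulation: its triangles correspond to tetrahedron corners, its edges to corners of faces, its vertices to ends of edges. **Frames.** In a triangulated surface $S$, a spine is a graph in the $1$-skeleton each component of whose complement in $S$ is an open disk. A frame is a spine that is minimal with respect to set inclusion among spines. A vertex on a frame is a branch point if its index (valence in the frame) is greater than $2$. A component of a frame minus its branch points is an open arc; its closure is called a branch. **The inflation triangulation $\mathcal{T}_\Lambda$.** By an inflation triangulation $\mathcal{T}_\Lambda$ is meant a triangulation produced from $\mathcal{T}^*$ and $\Lambda$ by the following construction. Direct each branch (arbitrarily)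 and label its edges successively. Each frame edge $x$ thus has an initial end $x^0$ and a terminal end $x^1$. Choose a transverse direction in the surface at the initial vertex of each branch by the right-hand rule (thumb pointing to the ideal vertex, index finger giving the transverse direction) and transport it along the branch. Direct each edge $E$ of $\mathcal{T}^*$ (arbitrarily) from an end $E^-$ to an end $E^+$. Each frame edge $x$ lies in a face $\sigma$ of $\mathcal{T}^*$ and cuts off a vertex $u$ of $\sigma$. Let $uw$ and $uw'$ be the sides of $\sigma$ containing $x^0$ and $x^1$ respectively. For each frame edge $x$ take a new tetrahedron $(x)$ with vertices $0,1,2,3$. Step A (inflation at faces). Let $\sigma$ be a face of $\mathcal{T}^*$ containing $m\in\{1,2,3\}$ frame edges, $\sigma$ being the identification of a face of a tetrahedron $(p)$ with a face of a tetrahedron $(p')$. Discard this identification. Choose an order $x^{(1)},\dots,x^{(m)}$ of the frame edges in $\sigma$. Insert the chain $(p),(x^{(1)}),\dots,(x^{(m)}),(p')$, consecutive members glued along a face. In $(x)$ the two faces used are $(023)$ and $(123)$: the face $(023)$ is towards $(p)$ and $(123)$ towards $(p')$ if the transverse direction of $x$ points from $(p)$ to $(p')$, and the reverse otherwise. The gluings are those obtained by labelling the vertices of $(x)$ by vertices of $\sigma$, with $2$ labelled $w$, $3$ labelled $w'$, and both $0$ and $1$ labelled $u$, and matching labels. Each $(x)$ then has two unidentified faces, $(012)$ associated with $x^0$ and $(013)$ associated with $x^1$, sharing the free edge $(01)$. Face identifications of $\mathcal{T}^*$ at faces containing no frame edge are kept. Step B (configuration polygons). Let $E$ be an edge of $\mathcal{T}^*$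 meeting the frames. Go cyclically once around $E$ through the faces of $\mathcal{T}^*$ incident to it (with multiplicity). At each such incidence of a face $\sigma$ along $E$, list the (at most two) frame edges $x$ in $\sigma$ having an endpoint on that side of $\sigma$, in the order determined by the insertion in Step A. Each listed edge gives an unidentified triangle of $(x)$ that has two edges that are copies of $E$ and one free edge located at the end $E^+$ or $E^-$ of $E$ where $x$ meets $E$. The cyclic sequence of these triangles is recorded as a planar polygon $P_E$ with one side per triangle, marked ''$+$'' or ''$-$'' according to whether the free edge is at $E^+$ or $E^-$. The vertices of $P_E$ correspond to the copies of $E$ shared by consecutive triangles. Step C (decomposition of $P_E$). Three basic configurations of marked polygons are: generic, a bigon with both sides having the same mark; branch, a $b$-gon with $b\ge3$ and all sides having the same mark; crossing, a quadrilateral whose marks alternate $+,-,+,-$. A link is a maximal sequence of adjacent sides with the same mark. Decompose $P_E$ as follows. (i) If all marks agree, do nothing. (ii) If there are exactly two links, pinch $P_E$ along an interior segment joining the two vertices at which the mark changes, obtaining two polygons each with all marks equal. (iii) If there are more than two links and some have length at least two, cut off each link of length at least two by a line segment joining its two end points, marked with the mark of that link; what remains has alternating marks and is treated by (iv). (iv) If marks alternate and there are four sides, do nothing. If marks alternate and there are at least six sides, choose a $+$ side $e^+$ and a $-$ side $e^-$ separated (on both sides) by at least two other sides and an interior point $v$, form the triangles $v*e^+$ with all sides marked $+$ and $v*e^-$ with all sides marked $-$, and repeat (iv) on the two remaining polygons, which have alternating marks. The result is a collection of basic configurations. Step D (inflation at edges). Each side of each resulting sub-polygon represents a triangle with two edges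 that are copies of $E$ (one for each end point of the side), meeting at the end of $E$ opposite to the mark, and a third edge at the end of $E$ given by the mark. For a generic bigon, identify the two triangles it represents, with no tetrahedron added. For a crossing, add one tetrahedron $(c)$ with vertices $0,1,2,3$, with vertices $0,2$ at the end $E^+$ and $1,3$ at the end $E^-$. Its edges $(01),(12),(23),(30)$ are in cyclic order the copies of $E$ corresponding to the vertices of the quadrilateral. Its faces $(012),(023)$ correspond to the $+$ sides and $(013),(123)$ to the $-$ sides. For a branch $b$-gon with mark $\varepsilon$, add the cone $0*P_b$ over a planar $b$-gon $P_b$, with cone point at the end of $E$ opposite to $\varepsilon$ and $P_b$ at the end $\varepsilon$. Its $b$ cone faces correspond to the sides. Glue the faces of these pieces to the unidentified triangles of $P_E$ (along sides of $P_E$) and to each other (along interior edges), matching the copies of $E$ at corresponding polygon vertices and preserving the ends $E^+,E^-$. Finally subdivide each $P_b$ into $b-2$ triangles without adding vertices (any choice) and cone, so that $0*P_b$ becomes $b-2$ tetrahedra; the triangles in $P_b$ remain unidentified. The collection of all tetrahedra of $\mathcal{T}^*$ and all added tetrahedra, with the retained and new face identifications, is $\mathcal{T}_\Lambda$. **Complexity.** Let $e(\Lambda)$ be the number of edges in the frames in $\Lambda$, $b(\Lambda)$ the number of branches of the frames in $\Lambda$, and $v_b(\Lambda)$ the number of branch points of the frames in $\Lambda$. Consider all possible orders for the inflations at the faces of $\mathcal{T}^*$ (Step A), and for each count the number of crossing configurations in the configuration polygons; the minimal such number is the crossing number $\times(\Lambda)$. The complexity of $\Lambda$ is $$\mathc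al{C}(\Lambda)=e(\Lambda)+\times(\Lambda)+2\,[\,b(\Lambda)-v_b(\Lambda)\,].$$
   Formalization: The orders chosen in Step A for the inflation at faces are required to realize the crossing number ×(Λ); for other orders the number of crossing configurations, and so of tetrahedra, is larger and the stated count fails. *)

(* Defs.v *)
From HB Require Import structures.
From Stdlib Require Import Relation_Operators.
From mathcomp Require Import all_boot all_order all_fingroup all_algebra.
From mathcomp Require Import generic_quotient.
From mathcomp Require Import all_classical all_reals all_analysis.
Import Order.TTheory GRing.Theory Num.Theory numFieldNormedType.Exports.

Set Implicit Arguments.
Unset Strict Implicit.
Unset Printing Implicit Defensive.

Notation v0 := (@Ordinal 4 0 isT).
Notation v1 := (@Ordinal 4 1 isT).
Notation v2 := (@Ordinal 4 2 isT).
Notation v3 := (@Ordinal 4 3 isT).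

(* Tetrahedra have vertices 'I_4, and face k is the face opposite vertex k.
   [glue t k = Some (t', p)] means that face k of t is paired with face [p k]
   of t' by the affine map sending vertex i <> k of t to vertex [p i] of t'. *)
Record gluing := Gluing {
  tet : finType;
  glue : tet -> 'I_4 -> option (tet * {perm 'I_4});
  glueK : forall t k t' p,
    glue t k = Some (t', p) -> glue t' (p k) = Some (t, (p^-1)%g);
  glue_neq : forall t k t' p, glue t k = Some (t', p) -> (t', p k) != (t, k)
}.

Section Topology.
Local Open Scope classical_set_scope.
Local Open Scope ring_scope.

Definition homeomorphic (S T : topologicalType) : Prop :=
  exists (f : S -> T) (g : T -> S),
    [/\ cancel f g, cancel g f, continuous f & continuous g].

Definition eq_closure (T : Type) (e : T -> T -> Prop) : rel T :=
  fun x y => `[< clos_refl_sym_trans T e x y >].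

Lemma eq_closure_refl T (e : T -> T -> Prop) : reflexive (eq_closure e).
Proof. by move=> x; apply/asboolP; exact: rst_refl. Qed.

Lemma eq_closure_sym T (e : T -> T -> Prop) : symmetric (eq_closure e).
Proof.
by move=> x y; apply/asboolP/asboolP => h; exact: rst_sym.
Qed.

Lemma eq_closure_trans T (e : T -> T -> Prop) : transitive (eq_closure e).
Proof.
by move=> y x z /asboolP xy /asboolP yz; apply/asboolP; exact: rst_trans xy yz.
Qed.

Definition eq_closure_equiv T (e : T -> T -> Prop) : equiv_rel T :=
  EquivRel (eq_closure e) (eq_closure_refl e) (eq_closure_sym e)
           (@eq_closure_trans T e).

Definition quot (T : topologicalType) (e : T -> T -> Prop) : topologicalType :=
  quotient_topology {eq_quot (eq_closure_equiv e)}%qT.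

Definition quot_map (T : topologicalType) (e : T -> T -> Prop) (x : T) :
  quot e := \pi_(quot e)%qT x.

Context (R : realType).

Definition half_space3 : set 'rV[R]_3 := [set v | 0 <= v ord0 ord0].
Definition sphere2 : set 'rV[R]_3 := [set v | \sum_i v ord0 i ^+ 2 = 1].
Definition open_disk : set 'rV[R]_2 := [set v | \sum_i v ord0 i ^+ 2 < 1].

Definition chart_at (X : topologicalType) (H : set 'rV[R]_3) (x : X) : Prop :=
  exists (U : set X) (V : set 'rV[R]_3),
    [/\ open U, U x, open V & homeomorphic (set_type U) (set_type (V `&` H))].

Definition compact_3manifold (X : topologicalType) : Prop :=
  [/\ compact [set: X], hausdorff_space X, @second_countable X
    & forall x : X, chart_at half_space3 x].

Definition manifold_interior (X : topologicalType) : set X :=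
  [set x | chart_at setT x].
Arguments manifold_interior : clear implicits.

Definition manifold_boundary (X : topologicalType) : set X :=
  ~` manifold_interior X.
Arguments manifold_boundary : clear implicits.

Definition no_sphere_boundary (X : topologicalType) : Prop :=
  forall x : X, manifold_boundary X x ->
    ~ homeomorphic (set_type (connected_component (manifold_boundary X) x))
                   (set_type sphere2).

(* Points of a tetrahedron, in barycentric coordinates. *)
Definition simplex : set 'rV[R]_4 :=
  [set w | (forall i, 0 <= w ord0 i) /\ \sum_i w ord0 i = 1].

Section Realization.
Context (T : gluing).

Definition tet_points : topologicalType := {t : tet T & set_type simplex}.

Definition face_identified (x y : tet_points) : Prop :=
  exists k p, [/\ glue (projT1 x) k = Some (projT1 y, p),
    \val (projT2 x) ord0 k = 0
    & \val (projT2 y) = col_perm p^-1%g (\val (projT2 x))].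

Definition realization : topologicalType := quot face_identified.

(* The quotient map is injective on the interior of every simplex; A is the
   set of vertices of a face of the tetrahedron t. *)
Definition is_triangulation : Prop :=
  forall (t : tet T) (A : {set 'I_4}) (w w' : set_type simplex),
    (forall i, (i \in A) = (\val w ord0 i != 0)) ->
    (forall i, (i \in A) = (\val w' ord0 i != 0)) ->
    quot_map face_identified (existT _ t w) =
      quot_map face_identified (existT _ t w') ->
    w = w'.

Definition ideal_vertices : set realization :=
  [set x | exists (t : tet T) (i : 'I_4) (w : set_type simplex),
     \val w = delta_mx ord0 i /\ x = quot_map face_identified (existT _ t w)].

Definition ideal_triangulation (X : topologicalType) : Prop :=
  is_triangulation /\
  homeomorphic (set_type (~` ideal_vertices)) (set_type (manifold_interior X)).

(* The normal triangle at corner (t, i) is represented by the points of face i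
   of t: its vertex on the edge ij corresponds to vertex j. *)
Definition link_points : topologicalType :=
  {c : tet T * 'I_4 & set_type [set w | simplex w /\ w ord0 c.2 = 0]}.

Definition link_identified (x y : link_points) : Prop :=
  exists k p, [/\ k != (projT1 x).2,
    glue (projT1 x).1 k = Some ((projT1 y).1, p),
    (projT1 y).2 = p (projT1 x).2,
    \val (projT2 x) ord0 k = 0
    & \val (projT2 y) = col_perm p^-1%g (\val (projT2 x))].

(* The disjoint union of all vertex-linking surfaces. *)
Definition link_space : topologicalType := quot link_identified.

End Realization.
End Topology.

Notation corner T := (tet T * 'I_4)%type.
Notation flag T := (tet T * 'I_4 * 'I_4)%type.
Notation hflag T := (tet T * 'I_4 * 'I_4 * 'I_4)%type.

Section LinkGraphs.
Context (T : gluing).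

(* A flag (t, i, a) with i <> a is used in two ways. As a link vertex, it is the
   end at i of the edge ia of t; thus it is also the edge ia directed from i to
   a. As a link edge, it is the corner at i of face a of t.
   An hflag (t, i, k, j) is the half of the link edge (t, i, k) at its end
   point (t, i, j). *)

Definition across (t : tet T) (k : 'I_4) (f : tet T -> {perm 'I_4} -> bool) :=
  if glue t k is Some (t', p) then f t' p else false.

Definition corner_adj : rel (corner T) := fun x y =>
  let: (t, i) := x in
  [exists k, (k != i) && across t k (fun t' p => y == (t', p i))].

Definition vertex_adj : rel (flag T) := fun x y =>
  let: (t, i, j) := x in
  [exists k, (k \notin [:: i; j]) && across t k (fun t' p => y == (t', p i, p j))].

Definition edge_adj : rel (flag T) := fun x y =>
  let: (t, i, k) := x in across t k (fun t' p => y == (t', p i, p k)).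

Definition half_adj : rel (hflag T) := fun x y =>
  let: (t, i, k, j) := x in across t k (fun t' p => y == (t', p i, p k, p j)).

Definition class (A : finType) (e : rel A) (x : A) : {set A} :=
  [set y | connect e x y].

Record link_graph := LinkGraph { gverts : {set flag T}; gedges : {set flag T} }.

Definition is_link_graph (G : link_graph) : Prop :=
  [/\ forall x, x \in gverts G -> x.1.2 != x.2,
      forall x, x \in gedges G -> x.1.2 != x.2,
      forall x y, vertex_adj x y -> x \in gverts G -> y \in gverts G,
      forall x y, edge_adj x y -> x \in gedges G -> y \in gedges G
    & forall t i k j, (t, i, k) \in gedges G -> j \notin [:: i; k] ->
        (t, i, j) \in gverts G].

Definition subgraph (G H : link_graph) : bool :=
  (gverts G \subset gverts H) && (gedges G \subset gedges H).

(* The part of G in the vertex-linking surface containing corner c. *)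
Definition graph_at (c : corner T) (G : link_graph) : link_graph :=
  LinkGraph [set x in gverts G | connect corner_adj c x.1]
            [set x in gedges G | connect corner_adj c x.1].

Section Frames.
Context (R : realType).
Local Open Scope classical_set_scope.
Local Open Scope ring_scope.

Definition link_surface (c : corner T) : set (link_space R T) :=
  [set x | exists c' w, connect corner_adj c c' /\
             x = quot_map (@link_identified R T) (existT _ c' w)].

Definition graph_points (G : link_graph) : set (link_space R T) :=
  [set x | exists c w, x = quot_map (@link_identified R T) (existT _ c w) /\
     ((exists j, (c, j) \in gverts G /\ \val w = delta_mx ord0 j) \/
      (exists k, (c, k) \in gedges G /\ \val w ord0 k = 0))].

Definition is_spine (c : corner T) (G : link_graph) : Prop :=
  [/\ is_link_graph G, subgraph G (graph_at c G)
    & forall x, (link_surface c `\` graph_points G) x ->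
        homeomorphic
          (set_type (connected_component (link_surface c `\` graph_points G) x))
          (set_type (@open_disk R))].

Definition is_frame (c : corner T) (G : link_graph) : Prop :=
  is_spine c G /\
  forall G', is_spine c G' -> subgraph G' G -> subgraph G G'.

(* A collection of frames, one from each vertex-linking surface, is given by
   the union of its members. *)
Definition is_frame_collection (L : link_graph) : Prop :=
  forall c : corner T, is_frame c (graph_at c L).

End Frames.

Section Counts.
Context (L : link_graph).

Definition halves : {set hflag T} :=
  [set h : hflag T | (h.1 \in gedges L) && (h.2 \notin [:: h.1.1.2; h.1.2])].

Definition half_end (h : hflag T) : flag T := (h.1.1, h.2).

Definition frame_index (v : flag T) : nat :=
  #|[set class half_adj h | h in halves & connect vertex_adj v (half_end h)]|.

Definition branch_point (v : flag T) : bool :=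
  (v \in gverts L) && (2 < frame_index v).

Definition num_edges : nat := #|[set class edge_adj x | x in gedges L]|.

Definition num_branch_points : nat :=
  #|[set class vertex_adj v | v in gverts L & branch_point v]|.

Definition strand_adj : rel (flag T) := fun x y =>
  edge_adj x y ||
  [exists h in halves, exists h' in halves,
    [&& h.1 == x, h'.1 == y, connect vertex_adj (half_end h) (half_end h')
      & ~~ branch_point (half_end h)]].

(* The edges of a component of the frames minus their branch points. *)
Definition strand (x : flag T) : {set flag T} := class strand_adj x.

(* A component of a frame minus its branch points whose closure contains no
   branch point is a closed curve or a point, not an open arc: it gives no
   branch. *)
Definition is_arc (S : {set flag T}) : bool :=
  [exists h in halves, (h.1 \in S) && branch_point (half_end h)].

Definition num_branches : nat :=
  #|[set strand x | x in gedges L & is_arc (strand x)]|.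

End Counts.
End LinkGraphs.

Section Polygons.
Context (T : gluing).

Definition rest (s : seq 'I_4) : 'I_4 := odflt v0 [pick v | v \notin s].

Context (L : link_graph T).

(* [ord t k] lists the corners of face k of t cut off by frame edges, in the
   order in which the frame edges are met when leaving t through face k. *)
Definition is_face_order (ord : tet T -> 'I_4 -> seq 'I_4) : Prop :=
  [/\ forall t k, uniq (ord t k),
      forall t k i, (i \in ord t k) = ((t, i, k) \in gedges L)
    & forall t k t' p, glue t k = Some (t', p) ->
        ord t' (p k) = rev (map p (ord t k))].

(* [pos (t, i, j)] means that the edge ij is directed from i, at its end E^-,
   to j, at its end E^+. *)
Definition is_edge_direction (pos : flag T -> bool) : Prop :=
  (forall t i j, i != j -> pos (t, j, i) = ~~ pos (t, i, j)) /\
  (forall x y : flag T, x.1.2 != x.2 -> vertex_adj x y -> pos x = pos y).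

(* The edges of the triangulation, each as a class of directed edges. *)
Definition edges (pos : flag T -> bool) : {set {set flag T}} :=
  [set class (@vertex_adj T) x | x : flag T & (x.1.2 != x.2) && pos x].

(* When going around an edge, the state (t, i, j, k) stands for the crossing of
   face k of t, which contains the edge ij, from t to the next tetrahedron. *)
Definition walk_step : rel (hflag T) := fun s s' =>
  let: (t, i, j, k) := s in
  across t k (fun t' p => s' == (t', p i, p j, rest [:: p i; p j; p k])).

(* The same incidence of face and edge, crossed in the other direction. *)
Definition crossed_back : rel (hflag T) := fun s s' =>
  let: (t, i, j, k) := s in across t k (fun t' p => s' == (t', p i, p j, p k)).

(* w goes cyclically once around E: each incidence of a face along E is crossed
   exactly once, in one of its two directions. *)
Definition goes_around (E : {set flag T}) (w : seq (hflag T)) : Prop :=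
  [/\ path.cycle walk_step w, uniq w,
      forall s, s \in w -> (s.1 \in E) && (s.2 \notin [:: s.1.1.2; s.1.2])
    & forall s : hflag T, s.1 \in E -> s.2 \notin [:: s.1.1.2; s.1.2] ->
        (s \in w) (+) has (crossed_back s) w].

(* A side of a polygon is oriented by the cyclic order. [Triangle (t, i, k, j)]
   is the unidentified triangle of (x), x = (t, i, k), associated with the end
   (t, i, j) of x; [Segment n b] is the n-th interior segment, the two values of
   b being its two orientations. *)
Inductive side_kind := Triangle of hflag T | Segment of nat & bool.

(* The Boolean is the mark: true for "+", false for "-". *)
Definition side : Type := (side_kind * bool)%type.

Definition config_polygon (ord : tet T -> 'I_4 -> seq 'I_4)
    (w : seq (hflag T)) : seq side :=
  flatten [seq (let: (t, i, j, k) := s in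
                [seq (Triangle (t, a, k, if a == i then j else i), a == j)
                | a <- ord t k & a \in [:: i; j]])
          | s <- w].

Definition mark (s : side) : bool := s.2.

(* The number of vertices of P at which the mark changes, which is the number
   of links unless all marks agree. *)
Definition num_links (P : seq side) : nat :=
  count (fun b => b.1 != b.2) (zip (map mark P) (rot 1 (map mark P))).

Definition alternating (P : seq side) : bool := num_links P == size P.

Definition same_mark (P : seq side) : bool := constant (map mark P).

Definition is_generic (P : seq side) : bool := same_mark P && (size P == 2).
Definition is_branch (P : seq side) : bool := same_mark P && (3 <= size P).
Definition is_crossing (P : seq side) : bool := alternating P && (size P == 4).
Definition is_basic (P : seq side) : bool :=
  [|| is_generic P, is_branch P | is_crossing P].

(* [decomposes n P ps n']: the polygon P is decomposed into the polygons ps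
   using interior segments numbered from n to n' - 1. *)
Inductive decomposes : nat -> seq side -> seq (seq side) -> nat -> Prop :=
| dec_rot n P r ps n' :
    decomposes n (rot r P) ps n' -> decomposes n P ps n'
| dec_same n P :
    same_mark P -> decomposes n P [:: P] n
| dec_pinch n e A B :
    A <> [::] -> B <> [::] ->
    all (fun s => mark s == e) A -> all (fun s => mark s == ~~ e) B ->
    decomposes n (A ++ B) [:: A; B] n
| dec_cut n e A b B ps n' :
    2 < num_links (A ++ b :: B) -> 2 <= size A ->
    all (fun s => mark s == e) A -> mark b = ~~ e -> mark (last b B) = ~~ e ->
    decomposes n.+1 ((Segment n true, e) :: b :: B) ps n' ->
    decomposes n (A ++ b :: B) (rcons A (Segment n false, e) :: ps) n'
| dec_crossing n P :
    alternating P -> size P = 4 -> decomposes n P [:: P] n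
| dec_split n ep A em B ps1 n1 ps2 n2 :
    alternating (ep :: A ++ em :: B) -> mark ep = true -> mark em = false ->
    2 <= size A -> 2 <= size B ->
    decomposes n.+4 (A ++ [:: (Segment n.+3 false, false);
                              (Segment n false, true)]) ps1 n1 ->
    decomposes n1 (B ++ [:: (Segment n.+1 false, true);
                            (Segment n.+2 false, false)]) ps2 n2 ->
    decomposes n (ep :: A ++ em :: B)
      ([:: [:: ep; (Segment n true, true); (Segment n.+1 true, true)],
           [:: em; (Segment n.+2 true, false); (Segment n.+3 true, false)]
         & ps1 ++ ps2]) n2.

(* Edges not meeting the frames have an empty polygon. *)
Definition is_decomposition (P : seq side) (ps : seq (seq side)) : Prop :=
  if P is [::] then ps = [::] else
  (exists n, decomposes 0 P ps n) /\ all is_basic ps.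

Definition are_configurations (ord : tet T -> 'I_4 -> seq 'I_4)
    (pos : flag T -> bool) (walk : {set flag T} -> seq (hflag T))
    (dec : {set flag T} -> seq (seq side)) : Prop :=
  is_edge_direction pos /\
  forall E, E \in edges pos ->
    goes_around E (walk E) /\
    is_decomposition (config_polygon ord (walk E)) (dec E).

(* With the orders ord there are n crossing configurations. *)
Definition has_crossings (ord : tet T -> 'I_4 -> seq 'I_4) (n : nat) : Prop :=
  exists pos walk dec, are_configurations ord pos walk dec /\
    n = \sum_(E in edges pos) count is_crossing (dec E).

Definition crossing_number : nat :=
  xget 0 [set n | (exists2 ord, is_face_order ord & has_crossings ord n) /\
                  (forall ord m, is_face_order ord -> has_crossings ord m ->
                     n <= m)]%classic.

Definition complexity : int :=
  ((num_edges L)%:Z + crossing_number%:Z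
   + 2 * ((num_branches L)%:Z - (num_branch_points L)%:Z))%R.

End Polygons.

Section Inflation.
Context (T : gluing) (L : link_graph T).

Record inflation_data := InflationData {
  (* for a frame edge x = (t, i, k), the vertex w of face k such that x^0 lies
     on the side iw *)
  init : flag T -> 'I_4;
  (* whether the transverse direction of x = (t, i, k) points out of t *)
  outward : flag T -> bool;
  face_order : tet T -> 'I_4 -> seq 'I_4;
  edge_dir : flag T -> bool;
  walk : {set flag T} -> seq (hflag T);
  pieces : {set flag T} -> seq (seq (side T));
  (* the subdivision of P_b into triangles, for the p-th polygon in P_E *)
  subdiv : {set flag T} -> nat -> seq (nat * nat * nat)
}.

Context (D : inflation_data).

Definition is_initial (h : hflag T) : bool := h.2 == init D h.1.

Definition are_branches_directed : Prop :=
  [/\ forall t i k, (t, i, k) \in gedges L -> init D (t, i, k) \notin [:: i; k],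
      forall t i k t' p, (t, i, k) \in gedges L -> glue t k = Some (t', p) ->
        init D (t', p i, p k) = p (init D (t, i, k))
    & forall h h', h \in halves L -> h' \in halves L ->
        connect (@vertex_adj T) (half_end h) (half_end h') ->
        ~~ branch_point L (half_end h) -> ~~ connect (@half_adj T) h h' ->
        is_initial h = ~~ is_initial h'].

Definition odd_order (s : seq 'I_4) : bool :=
  odd (\sum_(a < 4) \sum_(b < 4 | a < b) (nth v0 s b < nth v0 s a)).

(* A local orientation of the manifold at each link vertex: [eps (t, i, j)]
   says that near (t, i, j) the vertex order 0, 1, 2, 3 of t is positive. *)
Definition is_local_orientation (eps : flag T -> bool) : Prop :=
  forall t i j k t' p, i != j -> k \notin [:: i; j] ->
    glue t k = Some (t', p) ->
    eps (t', p i, p j) = eps (t, i, j) (+) ~~ odd_perm p.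

(* At its end (t, i, j) the transverse direction of the frame edge (t, i, k) is
   given by the right-hand rule: (thumb, index finger, direction of the branch)
   is a positive frame, the thumb pointing towards i. Seen from j, the vertices
   i and k and the other end of the frame edge are in the directions of the
   thumb, of the inward transverse direction, and away from j. *)
Definition right_handed (eps : flag T -> bool) (h : hflag T) : bool :=
  let: (t, i, k, j) := h in
  ((~~ odd_order [:: j; i; k; rest [:: i; k; j]]) == eps (t, i, j))
    (+) outward D (t, i, k) (+) ~~ is_initial h.

Definition is_transverse : Prop :=
  (forall t i k t' p, (t, i, k) \in gedges L -> glue t k = Some (t', p) ->
     outward D (t', p i, p k) = ~~ outward D (t, i, k)) /\
  exists eps, [/\ is_local_orientation eps,
    forall h, h \in halves L -> branch_point L (half_end h) -> is_initial h ->
      right_handed eps h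
  & forall h h', h \in halves L -> h' \in halves L ->
      connect (@vertex_adj T) (half_end h) (half_end h') ->
      ~~ branch_point L (half_end h) -> right_handed eps h = right_handed eps h'].

(* Tetrahedra of the inflation: those of T, one (x) for each frame edge x, and
   those added inside the p-th polygon of the decomposition of P_E. *)
Inductive cell :=
| Old of tet T
| Infl of {set flag T}
| Added of {set flag T} & nat & nat.

(* A triangle with an ordering of its vertices. *)
Definition otri : Type := (cell * ('I_4 * 'I_4 * 'I_4))%type.

Definition map3 (f : 'I_4 -> 'I_4) (s : 'I_4 * 'I_4 * 'I_4) :=
  (f s.1.1, f s.1.2, f s.2).

(* Going from t through face k, the frame edge x = (t, i, k) is entered by
   face (023) and left by face (123) if [outward D x], and conversely
   otherwise. [entry x] is the vertex 0 or 1 on the face entered. *)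
Definition entry (x : flag T) : 'I_4 := if outward D x then v0 else v1.
Definition exit (x : flag T) : 'I_4 := if outward D x then v1 else v0.

(* The vertex of (x) labelled a, on its face containing z and not the other
   of 0 and 1. *)
Definition label (x : flag T) (z a : 'I_4) : 'I_4 :=
  if a == x.1.2 then z else if a == init D x then v2 else v3.

Definition frame_cell (x : flag T) : cell := Infl (class (@edge_adj T) x).

(* The chain replacing the identification of face k of t with a face of t':
   each triangle of [leaving] is glued to the triangle of [entering] at the
   same position. *)
Definition leaving (t : tet T) (k : 'I_4) (s : 'I_4 * 'I_4 * 'I_4) : seq otri :=
  (Old t, s) ::
  [seq (frame_cell (t, i, k), map3 (label (t, i, k) (exit (t, i, k))) s)
  | i <- face_order D t k].

Definition entering (t : tet T) (k : 'I_4) (t' : tet T) (p : {perm 'I_4})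
    (s : 'I_4 * 'I_4 * 'I_4) : seq otri :=
  rcons [seq (frame_cell (t, i, k), map3 (label (t, i, k) (entry (t, i, k))) s)
        | i <- face_order D t k]
        (Old t', map3 p s).

(* For triangles represented by a side of a polygon, the vertices are ordered
   thus: the common vertex of the two copies of E, then the other vertices of
   the copies of E at the start and at the end of the side. *)
Definition frame_triangle (h : hflag T) : otri :=
  (frame_cell h.1, (if is_initial h then v2 else v3, entry h.1, exit h.1)).

Definition reverse (s : otri) : otri :=
  let: (c, (a, x, y)) := s in (c, (a, y, x)).

(* Triangulations, without added vertices, of the polygon with the given
   vertices. *)
Inductive polygon_subdiv : seq nat -> seq (nat * nat * nat) -> Prop :=
| subdiv_edge a b : polygon_subdiv [:: a; b] [::]
| subdiv_triangle a s b s' c q q' :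
    polygon_subdiv (a :: rcons s b) q -> polygon_subdiv (b :: rcons s' c) q' ->
    polygon_subdiv (a :: s ++ b :: rcons s' c) ((a, b, c) :: q ++ q').

(* In the cone 0 * P_b, the tetrahedron over (x, y, z) has the cone point as
   vertex 0 and x, y, z as vertices 1, 2, 3. *)
Definition base_vertex (q : nat * nat * nat) (a : 'I_4) : nat :=
  nth 0 [:: q.1.1; q.1.2; q.2] a.-1.

Inductive piece_triangle (E : {set flag T}) (p : nat) (Q : seq (side T))
    (r : nat) : otri -> Prop :=
| crossing_triangle (a x y : 'I_4) (b : side T) :
    is_crossing Q -> onth Q 0 = Some b ->
    (* the sides marked "+" are numbered 0 and 2 *)
    (x : nat) = (r + ~~ mark b) %% 4 ->
    (a : nat) = (x + 1) %% 4 -> (y : nat) = (x + 2) %% 4 ->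
    piece_triangle E p Q r (Added E p 0, (a, x, y))
| cone_triangle (q : nat) (u : nat * nat * nat) (x y : 'I_4) :
    is_branch Q -> onth (subdiv D E p) q = Some u ->
    x != v0 -> y != v0 ->
    base_vertex u x = r -> base_vertex u y = r.+1 %% size Q ->
    piece_triangle E p Q r (Added E p q, (v0, x, y)).

Inductive matched : otri -> otri -> Prop :=
| match_chain t k t' p (a b c : 'I_4) n s s' :
    glue t k = Some (t', p) -> uniq [:: k; a; b; c] ->
    onth (leaving t k (a, b, c)) n = Some s ->
    onth (entering t k t' p (a, b, c)) n = Some s' ->
    matched s s'
| match_generic E p Q h h' b b' :
    E \in edges (edge_dir D) -> onth (pieces D E) p = Some Q -> is_generic Q ->
    Q = [:: (Triangle h, b); (Triangle h', b')] ->
    matched (frame_triangle h) (reverse (frame_triangle h'))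
| match_side E p Q r h b s :
    E \in edges (edge_dir D) -> onth (pieces D E) p = Some Q ->
    onth Q r = Some (Triangle h, b) -> piece_triangle E p Q r s ->
    matched (frame_triangle h) s
| match_segment E n p Q r b s p' Q' r' b' s' :
    E \in edges (edge_dir D) ->
    onth (pieces D E) p = Some Q -> onth (pieces D E) p' = Some Q' ->
    onth Q r = Some (Segment T n true, b) ->
    onth Q' r' = Some (Segment T n false, b') ->
    piece_triangle E p Q r s -> piece_triangle E p' Q' r' s' ->
    matched s (reverse s')
| match_cone E p Q q u q' u' (x y x' y' : 'I_4) :
    E \in edges (edge_dir D) -> onth (pieces D E) p = Some Q -> is_branch Q ->
    onth (subdiv D E p) q = Some u -> onth (subdiv D E p) q' = Some u' ->
    q <> q' -> uniq [:: v0; x; y] -> uniq [:: v0; x'; y'] ->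
    base_vertex u x = base_vertex u' x' -> base_vertex u y = base_vertex u' y' ->
    matched (Added E p q, (v0, x, y)) (Added E p q', (v0, x', y')).

Inductive used_cell : cell -> Prop :=
| used_old t : used_cell (Old t)
| used_frame x : x \in gedges L -> used_cell (frame_cell x)
| used_crossing E p Q :
    E \in edges (edge_dir D) -> onth (pieces D E) p = Some Q -> is_crossing Q ->
    used_cell (Added E p 0)
| used_cone E p Q q :
    E \in edges (edge_dir D) -> onth (pieces D E) p = Some Q -> is_branch Q ->
    q < size (subdiv D E p) ->
    used_cell (Added E p q).

Definition are_choices : Prop :=
  [/\ are_branches_directed, is_transverse,
      is_face_order L (face_order D),
      are_configurations (face_order D) (edge_dir D) (walk D) (pieces D)
    & forall E p Q, E \in edges (edge_dir D) ->
        onth (pieces D E) p = Some Q -> is_branch Q ->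
        polygon_subdiv (iota 0 (size Q)) (subdiv D E p)].

(* The triangulation T' is the one produced by the choices D, its tetrahedra
   being named by cells. *)
Definition is_inflation (R : realType) (T' : gluing) : Prop :=
  [/\ is_triangulation R T', are_choices
    & exists name : tet T' -> cell,
      [/\ injective name,
          forall c, used_cell c <-> exists t, name t = c
        & forall t k t' p, glue t k = Some (t', p) <->
            exists a b c, uniq [:: k; a; b; c] /\
              (matched (name t, (a, b, c)) (name t', (p a, p b, p c)) \/
               matched (name t', (p a, p b, p c)) (name t, (a, b, c)))]].

End Inflation.

(* Main.v *)
(** Every cell outside [T] and the frame edges lies in a configuration polygon.
    A decomposition of a polygon with c > 0 changes of mark into basic
    configurations has c / 2 - 1 crossings, and its branch configurations carry
    (x - 2) + (y - 2) tetrahedra in all, x and y being the numbers of sides with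
    either mark (read 0 - 2 as 0; the value 1 cannot occur, because a single
    side of one mark admits no decomposition into basic configurations).

    Two walks around an edge agree up to rotation and reversal, so the number of
    crossings depends on the face orders only. The numbers x and y for [P_E] are
    the frame indices of the two ends of E; hence the branch configurations
    contribute the sum of (index - 2) over the branch points, which is twice
    the number of branches, minus 2 for each branch point, because each branch
    has two ends. *)
From mathcomp Require Import all_fingroup.
Require Import Defs.
From mathcomp Require Import all_boot all_order all_algebra.
From mathcomp Require Import all_classical all_reals all_analysis.
From mathcomp Require Import zify.

Set Implicit Arguments.
Unset Strict Implicit.
Unset Printing Implicit Defensive.

(** * Decompositions of marked polygons *)

Fixpoint changes (x : bool) (s : seq bool) : nat :=
  if s is y :: s' then (x != y) + changes y s' else 0.

(** The body of [num_links] on bare marks, so that [num_linksE] holds by conversion. *)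
Definition cyc_changes (m : seq bool) : nat :=
  count (fun b => b.1 != b.2) (zip m (rot 1 m)).

Lemma cyc_changes_cons x s : cyc_changes (x :: s) = changes x (rcons s x).
Proof.
(* The letter that closes the cycle is generalized apart from the head, because the head varies in
   the induction. *)
rewrite /cyc_changes rot1_cons; move: {2 4}x => z.
by elim: s x => [|y s IHs] x //=; rewrite IHs.
Qed.

Lemma changes_cat x s t :
  changes x (s ++ t) = changes x s + changes (last x s) t.
Proof. by elim: s x => [|y s IHs] x //=; rewrite IHs addnA. Qed.

Lemma changes_leq_size x s : changes x s <= size s.
Proof. by elim: s x => [|y s IHs] x //=; move: (IHs y); case: (x != y); lia. Qed.

Lemma changes_all x s : all (pred1 x) s -> changes x s = 0 /\ last x s = x.
Proof. by elim: s => [|y s IHs] //= /andP[/eqP -> /IHs[]]; rewrite eqxx. Qed.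

Lemma cyc_changes_constant m : constant m -> cyc_changes m = 0.
Proof.
case: m => [|x s] //= hs; rewrite cyc_changes_cons -cats1 changes_cat.
by have [-> ->] := changes_all hs; rewrite /= eqxx.
Qed.

Lemma constant_mem (m : seq bool) :
  m != [::] -> constant m = ~~ ((true \in m) && (false \in m)).
Proof.
case: m => // x s _ /=; apply/idP/idP => [hs|].
  apply/negP => /andP[ht hf].
  have hx y : y \in x :: s -> y = x.
    by rewrite inE => /predU1P[//|/(allP hs)/eqP].
  by move: (hx _ ht) (hx _ hf) => <-.
rewrite negb_and => /orP[] hn; apply/allP => y ys /=; apply/eqP.
  by move: hn; rewrite inE negb_or; case: x => //= /memPn/(_ y ys); case: y {ys}.
by move: hn; rewrite inE negb_or; case: x => //= /memPn/(_ y ys); case: y {ys}.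
Qed.

Lemma cyc_changes_mem m e : 0 < cyc_changes m -> e \in m.
Proof.
case: (m =P [::]) => [-> //|/eqP m0 h].
have: ~~ constant m by apply: contraTN h => /cyc_changes_constant ->.
by rewrite constant_mem // negbK => /andP[]; case: e.
Qed.

Lemma cyc_changes_rot r m : cyc_changes (rot r m) = cyc_changes m.
Proof.
suff h (s t : seq bool) : size s = size t -> zip (rot r s) (rot r t) = rot r (zip s t).
  by rewrite /cyc_changes rot_rot h ?size_rot // /rot count_cat addnC -count_cat cat_take_drop.
move=> st; rewrite /rot zip_cat ?size_drop ?st //; congr (_ ++ _).
  by elim: r s t {st} => [|r IHr] [|x s] [|y t] //=; rewrite ?drop0 //; case: drop.
by elim: r s t {st} => [|r IHr] [|x s] [|y t] //=; rewrite ?IHr //; case: take.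
Qed.

Lemma cyc_changes_rev m : cyc_changes (rev m) = cyc_changes m.
Proof.
rewrite -(rotrK 1 m); move: (rotr 1 m) => s.
rewrite cyc_changes_rot /cyc_changes -rev_rotr rotK -rev_zip ?size_rot //.
rewrite count_rev; move: (rot 1 s) => t.
by elim: s t => [|x s IHs] [|y t] //=; rewrite IHs eq_sym.
Qed.

Lemma cyc_changes_negb m : cyc_changes (map negb m) = cyc_changes m.
Proof.
rewrite /cyc_changes -map_rot; move: (rot 1 m) => s.
elim: m s => [|x m IH] [|y s] //=; rewrite IH; congr (_ + _).
by case: x; case: y.
Qed.

(** With two letters only, every change has [e] on exactly one of its sides, and an occurrence of
    [e] borders at most two changes. The terms for the first and last letters account for
    occurrences with a single neighbour; they cancel once the word is closed up. *)
Lemma changes_leq_count e x s :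
  changes x s + (last x s == e) <= (x == e) + 2 * count_mem e s.
Proof.
elim: s x => [|y s IHs] x /=; first by rewrite muln0 addn0.
rewrite -addnA mulnDr; apply: (leq_trans (leq_add (leqnn _) (IHs y))).
by rewrite !addnA leq_add2r; case: x; case: y; case: (e);
  rewrite /= ?addn0 ?add0n ?leqnn ?leq_addl ?leq_addr //; lia.
Qed.

Lemma cyc_changes_leq_count e m : cyc_changes m <= 2 * count_mem e m.
Proof.
case: m => // x s; rewrite cyc_changes_cons.
have := changes_leq_count e x (rcons s x).
rewrite last_rcons -cats1 count_cat /= addn0; set c := changes _ _.
by case: (x == e); lia.
Qed.

(** * Crossings and cone tetrahedra of a decomposition *)

Section Decomposition.
Context (T : gluing).
Implicit Types (P Q : seq (side T)) (ps : seq (seq (side T))).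

Lemma num_linksE P : num_links P = cyc_changes (map (@mark T) P).
Proof. by []. Qed.

Definition cone_cells ps : nat := \sum_(Q <- ps | is_branch Q) (size Q - 2).

Lemma is_branch_crossing Q : is_branch Q -> is_crossing Q = false.
Proof.
move=> /andP[/cyc_changes_constant h _]; apply/negP => /andP[/eqP].
by rewrite num_linksE h => <-.
Qed.

Lemma all_mark e P : all (fun s => mark s == e) P = all (pred1 e) (map (@mark T) P).
Proof. by rewrite all_map. Qed.

Lemma all_pred1_same_mark e P : all (fun s => mark s == e) P -> same_mark P.
Proof.
rewrite all_mark /same_mark; case: (map _ P) => //= x s /andP[/eqP ->].
by [].
Qed.

Lemma mem_all_pred1 (e f : bool) (m : seq bool) :
  all (pred1 e) m -> m != [::] -> (f \in m) = (f == e).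
Proof.
case: m => // x s hs _; apply/idP/eqP => [/(allP hs)/eqP //|->].
by move: hs => /= /andP[/eqP -> _]; rewrite mem_head.
Qed.

(** The changes inside [A], inside [B] and at the two returns to the other mark are bounded by
    [size A], [size B], 1 and 1. The total attains the sum of the bounds, so each of them is
    attained. *)
Lemma alternating_cut (e : bool) A B :
  cyc_changes (e :: A ++ ~~ e :: B) = (size A + size B).+2 ->
  [/\ changes e A = size A, last e A = e,
      changes (~~ e) B = size B & last (~~ e) B = ~~ e].
Proof.
rewrite cyc_changes_cons rcons_cat changes_cat rcons_cons /= -cats1 changes_cat /=.
move: (changes_leq_size e A) (changes_leq_size (~~ e) B).
case: e; case: (last _ A); case: (last _ B) => /= *; split => //; lia.
Qed.

(** For the polygon left on one side of a split in case (iv): the two new segments close [A] up to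
    an alternating cycle. *)
Lemma alternating_closed (e : bool) A :
  0 < size A -> changes e A = size A -> last e A = e ->
  cyc_changes (A ++ [:: ~~ e; e]) = (size A).+2.
Proof.
case: A => // a A _ /= + hl; rewrite cyc_changes_cons -cats1 -catA.
rewrite !changes_cat hl /=; move: (changes_leq_size a A).
by case: e {hl} => /=; case: a => /=; lia.
Qed.

(** Induction on the decomposition. A pinched polygon has two changes and no crossing; cutting off a
    link replaces it by one side of the same mark and keeps the changes; a crossing has four
    changes. A split turns |A| + |B| + 2 changes into |A| + 2 and |B| + 2, and the surplus 2 pays
    for the second polygon with both marks. The Boolean term lets polygons with a single mark obey
    the same equation. *)
Lemma decomposes_crossings n P ps n' : decomposes n P ps n' -> 0 < size P ->
  2 * count (@is_crossing T) ps
    + 2 * ((true \in map (@mark T) P) && (false \in map (@mark T) P))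
  = num_links P.
Proof.
have crossF Q : same_mark Q -> is_crossing Q = false.
  move=> /cyc_changes_constant h; apply/negP => /andP[/eqP].
  by rewrite num_linksE h => <-.
have both Q : 0 < num_links Q ->
    (true \in map (@mark T) Q) && (false \in map (@mark T) Q).
  by rewrite num_linksE => h; rewrite !cyc_changes_mem.
elim=> {n P ps n'}.
- move=> n P r ps n' _ IH P0; rewrite !num_linksE in IH *.
  rewrite map_rot !mem_rot cyc_changes_rot in IH; apply: IH.
  by rewrite size_rot.
- move=> n P h P0 /=; rewrite crossF // num_linksE cyc_changes_constant //.
  by move: h; rewrite /same_mark constant_mem; case: P P0 => //= ? ? _ /negPf ->.
- move=> n e A B A0 B0 hA hB _.
  rewrite /= !crossF ?(all_pred1_same_mark hA) ?(all_pred1_same_mark hB) //.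
  have -> : num_links (A ++ B) = 2.
    rewrite num_linksE map_cat.
    case: A B A0 B0 hA hB => [|a A] [|b B] // _ _ /= /andP[/eqP ha] + /andP[/eqP hb].
    rewrite ha hb !all_mark cyc_changes_cons => hA hB.
    rewrite -cats1 -catA /= !changes_cat; have [-> ->] := changes_all hA.
    rewrite /= changes_cat; have [-> ->] := changes_all hB.
    by case: e {hA hB ha hb}.
  rewrite map_cat !mem_cat.
  have mA : map (@mark T) A != [::] by case: (A) A0.
  have mB : map (@mark T) B != [::] by case: (B) B0.
  rewrite all_mark in hA; rewrite all_mark in hB.
  rewrite !(mem_all_pred1 _ hA mA) !(mem_all_pred1 _ hB mB).
  by case: e {hA hB}.
- move=> n e A b B ps n' h2 sA hA hb hB _ IH _.
  have E : num_links ((Segment T n true, e) :: b :: B) = num_links (A ++ b :: B).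
    rewrite !num_linksE map_cat; case: A sA hA {h2} => // a A _ /= /andP[/eqP ha].
    rewrite ha hb !cyc_changes_cons all_mark => hA.
    rewrite -!cats1 -catA !changes_cat; have [-> ->] := changes_all hA.
    by [].
  have := IH isT; rewrite E both ?E ?(ltn_trans _ h2) // both ?(ltn_trans _ h2) //=.
  rewrite crossF //; apply: (@all_pred1_same_mark e).
  by rewrite all_rcons hA /mark eqxx.
- move=> n P; rewrite /Defs.alternating => /eqP aP sP _.
  have b := both P; rewrite aP sP in b.
  by rewrite /= b // /is_crossing /Defs.alternating aP sP.
move=> n ep A em B ps1 n1 ps2 n2 aP mp mm sA sB _ IH1 _ IH2 _.
have tri Q : size Q = 3 -> is_crossing Q = false.
  by rewrite /is_crossing => ->; rewrite andbF.
move: aP; rewrite /Defs.alternating => /eqP aP.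
rewrite both ?aP //= !tri //.
rewrite size_cat /= count_cat.
move: aP; rewrite num_linksE map_cons map_cat map_cons mp mm /= size_cat /=.
rewrite -(size_map (@mark T) A) -(size_map (@mark T) B) addnS.
move=> /(@alternating_cut true)[a1 a2 a3 a4].
have := @alternating_closed true _ _ a1 a2; have := @alternating_closed false _ _ a3 a4.
rewrite !size_map => /(_ (ltnW sB)) /= cB /(_ (ltnW sA)) /= cA.
have := IH1; have := IH2; rewrite !both !num_linksE !map_cat ?cA ?cB // !size_cat.
by rewrite !addn2 => /(_ isT) h2 /(_ isT) h1; lia.
Qed.

Lemma crossing_same_mark Q : is_crossing Q -> same_mark Q = false.
Proof.
case/andP=> /eqP h /eqP s4; apply/negP => /cyc_changes_constant.
by rewrite -num_linksE h s4.
Qed.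

(** A generic bigon fits the count of [size Q - 2] cone tetrahedra as well, with value 0. *)
Lemma basic_same_mark Q : same_mark Q -> is_basic Q ->
  (if is_branch Q then size Q - 2 else 0) + 2 = size Q.
Proof.
move=> sQ; rewrite /is_basic /is_generic /is_branch sQ /=.
case/or3P=> [/eqP -> //|h|/crossing_same_mark]; last by rewrite sQ.
by rewrite h subnK // ltnW.
Qed.

Lemma basic_triangle Q : size Q = 3 -> is_basic Q -> is_branch Q.
Proof.
by move=> s3; rewrite /is_basic /is_generic /is_crossing s3 /= !andbF orbF.
Qed.

(** Each mark that occurs costs two sides. Cutting off a link of length l yields a branch (l +
    1)-gon with l - 1 tetrahedra and shortens the polygon by l - 1 sides. A split yields two
    triangles with one tetrahedron each and polygons with |A| + 2 and |B| + 2 sides, both showing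
    both marks. The equation is additive, so no truncated subtraction of the marks occurs. *)
Lemma decomposes_cones n P ps n' : decomposes n P ps n' -> 0 < size P ->
  all (@is_basic T) ps ->
  cone_cells ps + 2 * (true \in map (@mark T) P) + 2 * (false \in map (@mark T) P)
  = size P.
Proof.
rewrite /cone_cells.
elim=> {n P ps n'}.
- move=> n P r ps n' _ IH P0 hb.
  by have := IH; rewrite map_rot !mem_rot size_rot => ->.
- move=> n P h P0 /= /andP[hb _].
  rewrite big_mkcond big_seq1 -[RHS]basic_same_mark //.
  have : constant (map (@mark T) P) by [].
  rewrite constant_mem; last by case: P P0 {h hb}.
  have : (true \in map (@mark T) P) || (false \in map (@mark T) P).
    by case: P P0 {h hb} => // a P _ /=; rewrite !inE; case: (mark a); rewrite ?orbT.
  by case: (true \in _); case: (false \in _) => //= _ _; rewrite ?muln0 ?muln1 ?addn0.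
- move=> n e A B A0 B0 hA hB _ /= /and3P[bA bB _].
  rewrite big_mkcond !big_cons big_nil size_cat.
  have := basic_same_mark (all_pred1_same_mark hA) bA.
  have := basic_same_mark (all_pred1_same_mark hB) bB.
  have mA : map (@mark T) A != [::] by case: (A) A0.
  have mB : map (@mark T) B != [::] by case: (B) B0.
  rewrite all_mark in hA; rewrite all_mark in hB.
  rewrite map_cat !mem_cat.
  rewrite !(mem_all_pred1 _ hA mA) !(mem_all_pred1 _ hB mB).
  by case: e {hA hB} => /=; lia.
- move=> n e A b B ps n' h2 sA hA hb hB _ IH _ /= /andP[bA bps].
  have := IH isT bps; rewrite big_mkcond /= => {}IH.
  rewrite big_mkcond big_cons /=.
  have sm : same_mark (rcons A (Segment T n false, e)).
    by apply: (@all_pred1_same_mark e); rewrite all_rcons hA /mark eqxx.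
  have := basic_same_mark sm bA; rewrite size_rcons.
  have mA : map (@mark T) A != [::] by case: (A) sA.
  rewrite all_mark in hA.
  rewrite map_cat !mem_cat !(mem_all_pred1 _ hA mA) size_cat /=.
  rewrite !inE /mark /= in IH *; move: IH.
  move: (\sum_(Q <- ps | _) _) (if is_branch _ then _ else _) => c1 c2.
  move: (_ || _) (_ || _); clear => *; lia.
- move=> n P; rewrite /Defs.alternating => /eqP aP sP _ _.
  rewrite big_mkcond big_seq1 !cyc_changes_mem ?sP -?num_linksE ?aP ?sP //.
  case: ifP => // /is_branch_crossing.
  by rewrite /is_crossing /Defs.alternating aP sP.
move=> n ep A em B ps1 n1 ps2 n2 aP mp mm sA sB _ IH1 _ IH2 _ /and3P[b1 b2] ba.
have /andP[ba1 ba2] : all (@is_basic T) ps1 && all (@is_basic T) ps2 by rewrite -all_cat.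
have h1 := IH1 _ ba1; have h2 := IH2 _ ba2.
rewrite !size_cat !map_cat !addn2 !mem_cat /= !inE !eqxx !orbT /= in h1 h2.
have {}h1 := h1 isT; have {}h2 := h2 isT.
have mt : true \in map (@mark T) (ep :: A ++ em :: B) by rewrite map_cons inE mp.
have mf : false \in map (@mark T) (ep :: A ++ em :: B).
  by rewrite map_cons map_cat map_cons !(inE, mem_cat) mm !orbT.
rewrite mt mf !big_cons !basic_triangle // big_cat /= size_cat /=.
move: (\sum_(Q <- ps1 | _) _) (\sum_(Q <- ps2 | _) _) h1 h2; clear => c1 c2; lia.
Qed.

(** A basic polygon with a single mark has at least two sides, which settles the undivided and the
    pinched polygons. In the other cases there are more than two changes, and a lone side could
    account for only two. *)
Lemma decomposes_count n P ps n' e : decomposes n P ps n' -> 0 < size P ->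
  all (@is_basic T) ps -> count_mem e (map (@mark T) P) != 1.
Proof.
have big Q : 2 < num_links Q -> count_mem e (map (@mark T) Q) != 1.
  rewrite num_linksE => h; have := cyc_changes_leq_count e (map (@mark T) Q).
  by move: (count_mem _ _) => c; lia.
have basic Q : same_mark Q -> is_basic Q -> 2 <= size Q.
  by move=> h1 h2; rewrite -(basic_same_mark h1 h2) leq_addl.
have const (m : seq bool) f : all (pred1 f) m -> count_mem e m = (e == f) * size m.
  elim: m => [|x m IHm] /=; first by rewrite muln0.
  by case/andP=> /eqP -> /IHm ->; rewrite mulnS (eq_sym f).
elim=> {n P ps n'}.
- move=> n P r ps n' _ IH P0 hb; have := IH.
  by rewrite map_rot /rot count_cat addnC -count_cat cat_take_drop size_rot; apply.
- move=> n P h P0 /= /andP[hb _]; have := basic _ h hb.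
  move: h; rewrite /same_mark -(size_map (@mark T)).
  case: (map _ _) => // x m /= hm.
  rewrite -/(count_mem e (x :: m)) (const (x :: m) x) /= ?eqxx //.
  by case: (e == x) => /=; lia.
- move=> n f A B _ _ hA hB _ /= /and3P[bA bB _].
  have := basic _ (all_pred1_same_mark hA) bA.
  have := basic _ (all_pred1_same_mark hB) bB.
  rewrite map_cat count_cat; rewrite all_mark in hA; rewrite all_mark in hB.
  rewrite (const _ _ hA) (const _ _ hB) !size_map.
  by case: e {big const}; case: f {hA hB} => /=; lia.
- by move=> n f A b B ps n' h2 *; exact: big.
- by move=> n P aP sP _ _; apply: big; rewrite (eqP aP) sP.
move=> n ep A em B ps1 n1 ps2 n2 aP _ _ sA sB _ _ _ _ _ _.
by apply: big; rewrite (eqP aP) /= size_cat /=; lia.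
Qed.

End Decomposition.

Lemma polygon_subdiv_size l q : polygon_subdiv l q -> size q + 2 = size l.
Proof.
elim=> {l q} // a s b s' c q q' _ /= IH1 _ IH2.
move: IH1 IH2; rewrite /= !size_cat /= !size_rcons; lia.
Qed.

(** * Incidences of faces, edges and link vertices *)

(** Every step of [e] applies [f], so a path alternates between [x] and [f x]. No step is required
    at a fixed point of [f], which leaves room for unpaired faces. *)
Lemma connect_involution (A : finType) (e : rel A) (f : A -> A) :
  involutive f -> (forall x y, e x y -> y = f x) -> (forall x, f x != x -> e x (f x)) ->
  forall x y, connect e x y = (y == x) || (y == f x).
Proof.
move=> fK ef fe x y; apply/idP/orP => [|[]/eqP ->]; last 2 first.
- exact: connect0.
- by case: (eqVneq (f x) x) => [->|/fe/connect1].
case/connectP=> p; elim: p x => [|z p IHp] x /=; first by move=> _ ->; left.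
case/andP=> /ef -> /IHp h /h{h}; rewrite fK => -[]; by [right|left].
Qed.

Lemma mem_class (A : finType) (e : rel A) x y : (y \in class e x) = connect e x y.
Proof. by rewrite inE. Qed.

Lemma class_eq (A : finType) (e : rel A) : connect_sym e ->
  forall x y, (class e x == class e y) = connect e x y.
Proof.
move=> es x y; apply/eqP/idP => [h|xy]; first by rewrite -mem_class h mem_class connect0.
by apply/setP=> z; rewrite !mem_class; exact: same_connect.
Qed.

Lemma class_connect (A : finType) (e : rel A) x y : connect_sym e ->
  connect e x y -> class e y = class e x.
Proof. by move=> es xy; apply/eqP; rewrite class_eq // es. Qed.

(** Three vertices cannot exhaust ['I_4], so the default value in [rest] is never reached. *)
Lemma rest_notin (i j k : 'I_4) : rest [:: i; j; k] \notin [:: i; j; k].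
Proof.
rewrite /rest; case: pickP => //= h.
have := uniq_leq_size (enum_uniq 'I_4) (s2 := [:: i; j; k]) _.
rewrite -cardE card_ord; have hs : {subset enum 'I_4 <= [:: i; j; k]}.
  by move=> a _; have := h a; move/negbFE.
by move/(_ hs).
Qed.

Lemma rest_unique (i j k a : 'I_4) : uniq [:: i; j; k; a] -> rest [:: i; j; k] = a.
Proof.
move=> u; apply/eqP; apply: contraT => ra.
have : uniq (rest [:: i; j; k] :: [:: i; j; k; a]).
  rewrite cons_uniq u andbT; have := rest_notin i j k.
  by rewrite !inE !negb_or ra => /and3P[-> -> ->].
move/card_uniqP => h.
by have := max_card (mem (rest [:: i; j; k] :: [:: i; j; k; a])); rewrite h card_ord.
Qed.

Lemma rest_uniq (i j k : 'I_4) : uniq [:: i; j; k] -> uniq [:: i; j; k; rest [:: i; j; k]].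
Proof.
rewrite /= !inE !negb_or !andbT => /andP[/andP[ij ik] jk].
have := rest_notin i j k; rewrite !inE !negb_or => /and3P[ri rj rk].
by rewrite ij ik jk !(eq_sym _ (rest _)) ri rj rk.
Qed.

Section Incidences.
Context (T : gluing).
Implicit Types (s h : hflag T) (x y : flag T) (E : {set flag T}).

(** An unpaired face counts as glued to itself by the identity. This makes the maps below
    involutions of the whole type. *)
Definition nbr (t : tet T) (k : 'I_4) : tet T * {perm 'I_4} :=
  odflt (t, 1%g) (Defs.glue t k).

(** [cross] and [half_mate] read the face from different coordinates: the fourth in a walk state,
    the third in a half of a link edge. [swap_face] translates between the two. *)
Definition cross s : hflag T :=
  let: (t, i, j, k) := s in let: (t', p) := nbr t k in (t', p i, p j, p k).

Definition half_mate h : hflag T :=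
  let: (t, i, k, j) := h in let: (t', p) := nbr t k in (t', p i, p k, p j).

Definition edge_mate x : flag T :=
  let: (t, i, k) := x in let: (t', p) := nbr t k in (t', p i, p k).

Variant nbr_spec (t : tet T) (k : 'I_4) :
  option (tet T * {perm 'I_4}) -> tet T * {perm 'I_4} -> Prop :=
| NbrSome t' (p : {perm 'I_4}) of nbr t' (p k) = (t, p^-1%g) & Defs.glue t' (p k) = Some (t, p^-1%g)
    & (t', p k) != (t, k) & Defs.glue t k = Some (t', p) : nbr_spec t k (Some (t', p)) (t', p)
| NbrNone of nbr t k = (t, 1%g) & Defs.glue t k = None : nbr_spec t k None (t, 1%g).

Lemma nbrP t k : nbr_spec t k (Defs.glue t k) (nbr t k).
Proof.
rewrite /nbr; case E: (Defs.glue t k) => [[t' p]|] /=.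
  by have := glueK E => E'; constructor; rewrite ?(glue_neq E) // /nbr E'.
by constructor; rewrite /nbr E.
Qed.

Lemma crossK : involutive cross.
Proof.
case=> [[[t i] j] k]; rewrite /cross; case: nbrP => [t' p -> _ _ _|e _];
  by rewrite ?permK ?perm1 ?e ?perm1.
Qed.

Lemma half_mateK : involutive half_mate.
Proof.
case=> [[[t i] k] j]; rewrite /half_mate; case: nbrP => [t' p -> _ _ _|e _];
  by rewrite ?permK ?perm1 ?e ?perm1.
Qed.

Lemma edge_mateK : involutive edge_mate.
Proof.
case=> [[t i] k]; rewrite /edge_mate; case: nbrP => [t' p -> _ _ _|e _];
  by rewrite ?permK ?perm1 ?e ?perm1.
Qed.

Lemma half_mate_edge h : (half_mate h).1 = edge_mate h.1.
Proof. by case: h => [[[t i] k] j]; rewrite /half_mate /edge_mate /=; case: (nbr t k). Qed.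

Lemma connect_half_adj h h' :
  connect (@half_adj T) h h' = (h' == h) || (h' == half_mate h).
Proof.
apply: connect_involution => {h h'}; first exact: half_mateK.
  move=> [[[t i] k] j] h'; rewrite /half_adj /across /half_mate.
  by case: nbrP => [t' p _ _ _ _ /eqP|].
move=> [[[t i] k] j]; rewrite /half_adj /across /half_mate.
by case: nbrP => [t' p _ _ _ _ _|_ _]; rewrite ?perm1 eqxx.
Qed.

Lemma connect_edge_adj x y :
  connect (@edge_adj T) x y = (y == x) || (y == edge_mate x).
Proof.
apply: connect_involution => {x y}; first exact: edge_mateK.
  move=> [[t i] k] h'; rewrite /edge_adj /across /edge_mate.
  by case: nbrP => [t' p _ _ _ _ /eqP|].
move=> [[t i] k]; rewrite /edge_adj /across /edge_mate.
by case: nbrP => [t' p _ _ _ _ _|_ _]; rewrite ?perm1 eqxx.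
Qed.

Lemma half_adj_sym : connect_sym (@half_adj T).
Proof.
move=> h h'; rewrite !connect_half_adj (eq_sym h' (half_mate h)).
by rewrite (canF_eq half_mateK) (eq_sym h h').
Qed.

Lemma edge_adj_sym : connect_sym (@edge_adj T).
Proof.
by move=> x y; rewrite !connect_edge_adj (eq_sym y (edge_mate x)) (canF_eq edge_mateK) (eq_sym x y).
Qed.

Lemma vertex_adjP x y : reflect
  (exists t' p k, [/\ Defs.glue x.1.1 k = Some (t', p), k \notin [:: x.1.2; x.2]
     & y = (t', p x.1.2, p x.2)])
  (vertex_adj x y).
Proof.
case: x => [[t i] j]; apply: (iffP existsP) => /=.
  case=> k /andP[kij]; rewrite /across; case E: (Defs.glue t k) => [[t' p]|//] /eqP ->.
  by exists t', p, k.
case=> t' [p [k [E kij ->]]]; exists k; by rewrite kij /across E eqxx.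
Qed.

Lemma vertex_adj_symmetric : symmetric (@vertex_adj T).
Proof.
suff h x y : vertex_adj x y -> vertex_adj y x by move=> x y; apply/idP/idP => /h.
case: x => [[t i] j] /vertex_adjP[t' [p [k /= [E kij ->]]]].
apply/vertex_adjP; exists t, (p^-1)%g, (p k) => /=; rewrite (glueK E) !permK; split=> //.
by move: kij; rewrite !inE !(inj_eq perm_inj).
Qed.

Lemma vertex_adj_sym : connect_sym (@vertex_adj T).
Proof. exact: sym_connect_sym vertex_adj_symmetric. Qed.

Lemma half_mate_end h : uniq [:: h.1.1.2; h.1.2; h.2] ->
  connect (@vertex_adj T) (half_end h) (half_end (half_mate h)).
Proof.
case: h => [[[t i] k] j] /=; rewrite /half_end /= !inE !negb_or !andbT => /andP[/andP[ik ij] kj].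
case: nbrP => [t' p _ _ _ E|_ _] /=; last by rewrite !perm1 connect0.
apply: connect1; apply/vertex_adjP; exists t', p, k => /=; split => //.
by rewrite !inE negb_or eq_sym ik kj.
Qed.

Definition nondeg s : bool := uniq [:: s.1.1.2; s.1.2; s.2].

(** Passage to the other face of the same tetrahedron through the edge ij. *)
Definition turn s : hflag T :=
  let: (t, i, j, k) := s in (t, i, j, rest [:: i; j; k]).

(** A total function extending [walk_step], so that a walk becomes an orbit of a function. *)
Definition step s : hflag T := turn (cross s).

Lemma nondeg_cross s : nondeg (cross s) = nondeg s.
Proof.
case: s => [[[t i] j] k]; rewrite /nondeg /cross; case: (nbr t k) => t' p.
exact: (map_inj_uniq (@perm_inj _ p) [:: i; j; k]).
Qed.

Lemma uniq_swap_last (i j k l : 'I_4) : uniq [:: i; j; k; l] = uniq [:: i; j; l; k].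
Proof. by apply: perm_uniq; rewrite !perm_cons (perm_catC [:: k] [:: l]). Qed.

Lemma turnK s : nondeg s -> turn (turn s) = s.
Proof.
case: s => [[[t i] j] k]; rewrite /nondeg /turn => u; congr (_, _).
by apply: rest_unique; rewrite uniq_swap_last rest_uniq.
Qed.

Lemma nondeg_turn s : nondeg s -> nondeg (turn s).
Proof.
case: s => [[[t i] j] k]; rewrite /nondeg /turn => /rest_uniq.
rewrite uniq_swap_last -[X in uniq X]/([:: i; j; rest [:: i; j; k]] ++ [:: k]) cat_uniq.
by case/andP.
Qed.

Lemma walk_stepE s s' : walk_step s s' -> s' = step s.
Proof.
case: s => [[[t i] j] k]; rewrite /walk_step /across /step /cross.
by case: nbrP => [t' p _ _ _ _ /eqP ->|].
Qed.

Lemma vertex_adj_neq x y : connect (@vertex_adj T) x y -> (y.1.2 == y.2) = (x.1.2 == x.2).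
Proof.
case/connectP=> p + ->; elim: p x => [|z p IHp] x //= /andP[/vertex_adjP[t' [q [k [_ _ ->]]]]].
by move/IHp => -> /=; rewrite (inj_eq perm_inj).
Qed.

(* Link vertices, each of which is also a directed edge of the triangulation. *)
Definition link_vertices : {set {set flag T}} :=
  [set class (@vertex_adj T) x | x : flag T & x.1.2 != x.2].

Lemma link_vertex_neq E x : E \in link_vertices -> x \in E -> x.1.2 != x.2.
Proof.
case/imsetP=> y; rewrite inE => yy ->.
by rewrite mem_class => /vertex_adj_neq ->.
Qed.

Lemma link_vertex_class E x : E \in link_vertices -> x \in E -> E = class (@vertex_adj T) x.
Proof.
case/imsetP=> y _ ->; rewrite mem_class => yx.
by rewrite (class_connect vertex_adj_sym yx).
Qed.

Definition flip x : flag T := (x.1.1, x.2, x.1.2).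

Lemma flipK : involutive flip.
Proof. by case=> [[t i] j]. Qed.

(** Viewed as a link vertex, this is the other end of the same edge. *)
Definition reverse_edge E : {set flag T} := flip @: E.

Lemma reverse_edgeK : involutive reverse_edge.
Proof.
move=> E; rewrite /reverse_edge -imset_comp -[RHS]imset_id.
by apply: eq_imset => x /=; exact: flipK.
Qed.

Lemma mem_reverse_edge E x : (x \in reverse_edge E) = (flip x \in E).
Proof. by rewrite -{1}(flipK x) mem_imset //; exact: (can_inj flipK). Qed.

Lemma vertex_adj_flip x y : vertex_adj (flip x) (flip y) = vertex_adj x y.
Proof.
suff h u v : vertex_adj u v -> vertex_adj (flip u) (flip v).
  by apply/idP/idP => /h //; rewrite !flipK.
case/vertex_adjP=> t' [p [k [E kij ->]]]; apply/vertex_adjP.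
exists t', p, k; split => //=; by move: kij; rewrite !inE orbC.
Qed.

Lemma connect_flip x y :
  connect (@vertex_adj T) (flip x) (flip y) = connect (@vertex_adj T) x y.
Proof.
suff h u v : connect (@vertex_adj T) u v -> connect (@vertex_adj T) (flip u) (flip v).
  by apply/idP/idP => /h //; rewrite !flipK.
case/connectP=> p + ->; elim: p u => [|z p IHp] u //=.
case/andP=> uz /IHp; apply: connect_trans; apply: connect1.
by rewrite vertex_adj_flip.
Qed.

Lemma reverse_class x :
  reverse_edge (class (@vertex_adj T) x) = class (@vertex_adj T) (flip x).
Proof.
by apply/setP => y; rewrite mem_reverse_edge !mem_class -connect_flip flipK.
Qed.

Lemma reverse_link_vertex E : (reverse_edge E \in link_vertices) = (E \in link_vertices).
Proof.
suff h F : F \in link_vertices -> reverse_edge F \in link_vertices.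
  by apply/idP/idP => /h //; rewrite reverse_edgeK.
case/imsetP=> x; rewrite inE => xx ->; rewrite reverse_class imset_f // inE /=.
by rewrite eq_sym.
Qed.

(** * Edges and their two ends *)

Section Directions.
Context (pos : flag T -> bool) (dpos : is_edge_direction pos).

Lemma mem_edges x : x.1.2 != x.2 -> (class (@vertex_adj T) x \in edges pos) = pos x.
Proof.
move=> xx; apply/imsetP/idP => [[y]|px]; last by exists x => //; rewrite inE xx px.
rewrite inE => /andP[yy py] /eqP; rewrite class_eq; last exact: vertex_adj_sym.
rewrite vertex_adj_sym => /connectP[p pp ->].
elim: p y yy py pp => [|z p IHp] y yy py //= /andP[yz].
apply: IHp; last by rewrite -(dpos.2 _ _ yy yz).
by rewrite (vertex_adj_neq (connect1 yz)).
Qed.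

Lemma edges_link_vertices E : E \in edges pos -> E \in link_vertices.
Proof. by case/imsetP=> x; rewrite inE => /andP[xx _] ->; rewrite imset_f // inE. Qed.

Lemma reverse_edges E : E \in link_vertices ->
  (reverse_edge E \in edges pos) = (E \notin edges pos).
Proof.
case/imsetP=> -[[t i] j]; rewrite inE => xx ->; rewrite reverse_class.
by rewrite !mem_edges //= ?(eq_sym j) // dpos.1.
Qed.

(** A directed edge is its own end [E^-], and its reverse is the end [E^+]. The right-hand side no
    longer mentions [pos], which frees edge counts from the choice of directions. *)
Lemma sum_link_vertices (F : {set flag T} -> nat) :
  \sum_(E in edges pos) (F E + F (reverse_edge E)) = \sum_(V in link_vertices) F V.
Proof.
rewrite big_split [RHS](bigID (mem (edges pos))) /=; congr (_ + _).
  apply: eq_bigl => E; case: (boolP (E \in edges pos)); last by rewrite andbF.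
  by move/edges_link_vertices ->.
rewrite [RHS](reindex_inj (can_inj reverse_edgeK)) /=; apply: eq_bigl => E.
rewrite reverse_link_vertex; apply/idP/andP => [h|[h]].
  have h' := edges_link_vertices h; split => //.
  by rewrite reverse_edges // negbK.
by rewrite reverse_edges // negbK.
Qed.

End Directions.

End Incidences.

(** * Walks around an edge *)

Section Walks.
Context (T : gluing).
Implicit Types (s h : hflag T) (x y : flag T) (E : {set flag T}).

Lemma nondegE s :
  nondeg s = (s.1.1.2 != s.1.2) && (s.2 \notin [:: s.1.1.2; s.1.2]).
Proof.
rewrite /nondeg /= !inE !negb_or andbT -andbA; congr (_ && _).
by rewrite !(eq_sym s.2).
Qed.

Lemma goes_around_nondeg E w s : E \in link_vertices T -> goes_around E w ->
  s \in w -> nondeg s.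
Proof.
move=> vE [_ _ hw _] /hw/andP[sE sk]; rewrite nondegE sk andbT.
exact: link_vertex_neq sE.
Qed.

(** On a paired face, [cross s] is the only state related to [s] by [crossed_back]. On an unpaired
    face there is none, so [s] would lie in [w], where it could have no successor. *)
Lemma goes_around_mem E w s : E \in link_vertices T -> goes_around E w ->
  s.1 \in E -> nondeg s -> Defs.glue s.1.1.1 s.2 /\ (cross s \in w) = (s \notin w).
Proof.
move=> vE [cw _ _ hw] sE; rewrite nondegE => /andP[_ sk]; have := hw s sE sk.
case: s sE sk => [[[t i] j] k] /= _ _; rewrite /crossed_back /across /cross.
case: nbrP => [t' p _ _ _ _|_ e].
  by rewrite has_pred1; case: (_ \in w); case: (_ \in w).
have -> : has (fun=> false) w = false by elim: (w).
rewrite addbF => /(next_cycle cw); by rewrite /walk_step /across e.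
Qed.

Lemma goes_around_fcycle E w : goes_around E w -> path.cycle (frel (@step T)) w.
Proof. by case=> cw _ _ _; apply: sub_cycle cw => s s' /walk_stepE ->; rewrite /= eqxx. Qed.

Lemma goes_around_neq0 E w : E \in link_vertices T -> goes_around E w ->
  exists s, [/\ s.1 \in E, nondeg s & (s \in w) || (cross s \in w)].
Proof.
move=> vE gw; have [x xE] : exists x, x \in E.
  by case/imsetP: (vE) => x _ ->; exists x; rewrite mem_class connect0.
(* Repeating an end point of the edge makes [rest] pick some vertex off the edge, hence a face
   containing it. *)
have nd : nondeg (x, rest [:: x.1.2; x.2; x.2]).
  rewrite nondegE (link_vertex_neq vE xE) /=; have := rest_notin x.1.2 x.2 x.2.
  by rewrite !inE !negb_or => /and3P[-> ->].
exists (x, rest [:: x.1.2; x.2; x.2]); split => //.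
by have [_ ->] := goes_around_mem vE gw (s := (_, _)) xE nd; case: (_ \in w).
Qed.

(** The reversed walk, with every crossing taken backwards, is again a cycle of [step]. As each
    incidence is crossed once in one direction, [w'] shares a state with [w] or with this reversal,
    and cycles of a function that share a state coincide up to rotation. *)
Lemma goes_around_unique E w w' : E \in link_vertices T ->
  goes_around E w -> goes_around E w' ->
  exists r, w' = rot r w \/ w' = rot r (rev (map (@cross T) w)).
Proof.
move=> vE gw gw'.
(* Both cycles are rotations of the orbit of the common state [s]. *)
have rot_cycle u v s : path.cycle (frel (@step T)) u -> path.cycle (frel (@step T)) v ->
    uniq u -> uniq v -> s \in u -> s \in v -> exists r, v = rot r u.
  move=> cu cv uu uv su sv.
  have [i ei] := orbit_rot_cycle cu uu su; have [j ej] := orbit_rot_cycle cv uv sv.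
  exists (rot_add u i (size (rot i u) - j)).
  by rewrite -rot_rot_add -[LHS](rotK j) -ej ei.
have cw := goes_around_fcycle gw; have cw' := goes_around_fcycle gw'.
have uw : uniq w by case: gw.
have uw' : uniq w' by case: gw'.
pose v := rev (map (@cross T) w).
have uv : uniq v by rewrite rev_uniq map_inj_uniq //; exact: (can_inj (@crossK T)).
(* Since [cross] and [turn] are involutions, [step] takes [cross (step s)] to [cross s]. *)
have cv : path.cycle (frel (@step T)) v.
  rewrite rev_cycle cycle_map.
  apply: (@sub_in_cycle _ (@nondeg T) (frel (@step T))) cw; last first.
    by apply/allP => s; apply: (goes_around_nondeg vE gw).
  move=> s s' ns _ /eqP <-; rewrite /= {1}/step crossK /step turnK //.
  by rewrite nondeg_cross.
have memv s : (s \in v) = (cross s \in w).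
  by rewrite mem_rev -{1}(crossK s) mem_map //; exact: (can_inj (@crossK T)).
have [s [sE ns sw]] := goes_around_neq0 vE gw.
have [_ e] := goes_around_mem vE gw sE ns.
have [_ e'] := goes_around_mem vE gw' sE ns.
have [s' sw'] : exists s', (s' \in w') && ((s' \in w) || (cross s' \in w)).
  case: (boolP (s \in w')) e' => [h _|_ h]; first by exists s; rewrite h.
  by exists (cross s); rewrite h crossK orbC.
case/andP: sw' => s'w' /orP[h|h].
  by have [r ->] := rot_cycle _ _ _ cw cw' uw uw' h s'w'; exists r; left.
rewrite -memv in h.
by have [r ->] := rot_cycle _ _ _ cv cw' uv uw' h s'w'; exists r; right.
Qed.

Definition flip_state s : hflag T := (flip s.1, s.2).

Lemma flip_stateK : involutive flip_state.
Proof. by case=> x k; rewrite /flip_state flipK. Qed.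

Lemma mem_map_flip_state s w : (flip_state s \in map flip_state w) = (s \in w).
Proof. by rewrite mem_map //; exact: (can_inj flip_stateK). Qed.

Lemma walk_step_flip s s' : walk_step (flip_state s) (flip_state s') = walk_step s s'.
Proof.
case: s s' => [[[t i] j] k] [[[t' i'] j'] k']; rewrite /walk_step /across /flip_state /=.
case: Defs.glue => // -[u p]; rewrite !xpair_eqE.
have -> : rest [:: p j; p i; p k] = rest [:: p i; p j; p k].
  by rewrite /rest; congr odflt; apply: eq_pick => a; rewrite !inE orbCA.
by rewrite -!andbA; congr (_ && _); rewrite andbCA.
Qed.

Lemma crossed_back_flip s s' :
  crossed_back (flip_state s) (flip_state s') = crossed_back s s'.
Proof.
case: s s' => [[[t i] j] k] [[[t' i'] j'] k']; rewrite /crossed_back /across /flip_state /=.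
case: Defs.glue => // -[u p]; rewrite !xpair_eqE.
by rewrite -!andbA; congr (_ && _); rewrite andbCA.
Qed.

Lemma goes_around_flip E w :
  goes_around E w -> goes_around (reverse_edge E) (map flip_state w).
Proof.
case=> cw uw h1 h2; split.
- rewrite cycle_map; apply: sub_cycle cw => s s'.
  by rewrite -walk_step_flip.
- by rewrite map_inj_uniq //; exact: (can_inj flip_stateK).
- move=> s; rewrite -(flip_stateK s) mem_map_flip_state => /h1.
  by rewrite mem_reverse_edge /= flipK !inE orbC.
move=> s; rewrite -(flip_stateK s) mem_reverse_edge /= flipK => sE hs.
rewrite mem_map_flip_state has_map.
rewrite (eq_has (a2 := crossed_back (flip_state s))) => [|s']; last exact: crossed_back_flip.
by apply: h2 => //; move: hs; rewrite !inE orbC.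
Qed.

(** * Marks along a walk and the number of crossings *)

Section Marks.
Context (L : link_graph T) (ord : tet T -> 'I_4 -> seq 'I_4).
Hypothesis ordL : is_face_order L ord.

Definition side_marks s : seq bool :=
  let: (t, i, j, k) := s in [seq a == j | a <- ord t k & a \in [:: i; j]].

Definition walk_marks (w : seq (hflag T)) : seq bool := flatten (map side_marks w).

Lemma mark_config_polygon w : map (@mark T) (config_polygon ord w) = walk_marks w.
Proof.
rewrite /config_polygon map_flatten -map_comp; congr flatten.
by apply: eq_map => -[[[t i] j] k] /=; rewrite -map_comp.
Qed.

Lemma side_marks_cross s : Defs.glue s.1.1.1 s.2 -> side_marks (cross s) = rev (side_marks s).
Proof.
case: s => [[[t i] j] k] /=; case: nbrP => [t' p _ _ _ e|//] _; rewrite /side_marks.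
have [_ _ /(_ _ _ _ _ e) ->] := ordL.
rewrite filter_rev map_rev filter_map -map_comp; congr rev.
rewrite (eq_filter (a2 := [in [:: i; j]])) => [|a].
  by apply: eq_map => a /=; rewrite (inj_eq perm_inj).
by rewrite /= !inE !(inj_eq perm_inj).
Qed.

Lemma side_marks_flip s : nondeg s -> side_marks (flip_state s) = map negb (side_marks s).
Proof.
case: s => [[[t i] j] k]; rewrite nondegE /= => /andP[ij _].
rewrite (eq_filter (a2 := [in [:: i; j]])) => [|a]; last by rewrite !inE orbC.
rewrite -map_comp; apply/eq_in_map => a; rewrite mem_filter !inE => /andP[].
by case/orP=> /eqP -> _ /=; rewrite eqxx ?(negPf ij) // eq_sym (negPf ij).
Qed.

Lemma walk_marks_flip w : all (@nondeg T) w ->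
  walk_marks (map flip_state w) = map negb (walk_marks w).
Proof.
move=> /allP nw; rewrite /walk_marks map_flatten -!map_comp; congr flatten.
by apply/eq_in_map => s /nw /side_marks_flip.
Qed.

Lemma cyc_changes_catC (s t : seq bool) : cyc_changes (s ++ t) = cyc_changes (t ++ s).
Proof. by rewrite -(cyc_changes_rot (size s)) rot_size_cat. Qed.

(** Crossing a face backwards reverses its block of marks, so the reversed walk reads the whole
    cyclic word backwards; changes are invariant under rotation and reversal. *)
Lemma walk_marks_links E w w' : E \in link_vertices T ->
  goes_around E w -> goes_around E w' ->
  cyc_changes (walk_marks w') = cyc_changes (walk_marks w).
Proof.
move=> vE gw gw'.
have rotw r u : cyc_changes (walk_marks (rot r u)) = cyc_changes (walk_marks u).
  by rewrite /walk_marks map_rot /rot flatten_cat cyc_changes_catC -flatten_cat cat_take_drop.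
have [r [->|->]] := goes_around_unique vE gw gw'; rewrite rotw //.
rewrite -cyc_changes_rev /walk_marks rev_flatten map_rev map_rev revK -2!map_comp.
congr (cyc_changes (flatten _)); apply/eq_in_map => s sw /=.
have ns := goes_around_nondeg vE gw sw.
have sE : s.1 \in E by case: gw => _ _ /(_ s sw)/andP[].
by rewrite side_marks_cross ?revK //; case: (goes_around_mem vE gw sE ns).
Qed.

(** If there is a change, both marks occur and the Boolean term of [decomposes_crossings] equals 1.
    If there is none, the truncated predecessor gives the required 0. *)
Lemma config_crossings P ps : is_decomposition P ps ->
  count (@is_crossing T) ps = (num_links P)./2.-1.
Proof.
case: P => [|a P]; first by move=> /= ->.
case=> -[n /decomposes_crossings/(_ isT)] + _; rewrite num_linksE.
set m := map _ _; case: (posnP (cyc_changes m)) => [->|h]; first by lia.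
by rewrite !cyc_changes_mem //= => <-; lia.
Qed.

End Marks.

(** Two families of configurations may direct an edge differently, so their counts are compared as
    sums over link vertices, where each edge appears with both ends. *)
Lemma has_crossings_unique (L : link_graph T) (ord : tet T -> 'I_4 -> seq 'I_4) n m :
  is_face_order L ord ->
  has_crossings ord n -> has_crossings ord m -> n = m.
Proof.
move=> ordL.
have ext c : has_crossings ord c -> exists W : {set flag T} -> seq (hflag T),
    (forall E, E \in link_vertices T -> goes_around E (W E)) /\
    2 * c = \sum_(E in link_vertices T) (cyc_changes (walk_marks ord (W E)))./2.-1.
  case=> pos [walk [dec [[dpos hE] ->]]].
  (* The walks are extended to all link vertices by flipping. A flip negates the marks and keeps the
     changes, so both ends contribute the same number and the sum is [2 * c]. *)
  pose W E := if E \in edges pos then walk E else map flip_state (walk (reverse_edge E)).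
  have gW E : E \in link_vertices T -> goes_around E (W E).
    move=> vE; rewrite /W; case: ifP => [/hE[] //|/negbT nE].
    rewrite -{1}(reverse_edgeK E); apply: goes_around_flip.
    by have [] := hE (reverse_edge E) _; rewrite ?(reverse_edges dpos).
  exists W; split => //; rewrite -(sum_link_vertices dpos) big_distrr /=.
  apply: eq_bigr => E eE; have [gE dE] := hE E eE.
  have vE := edges_link_vertices eE.
  rewrite (config_crossings dE) num_linksE mark_config_polygon.
  rewrite {1}/W eE /W reverse_edges // eE /= reverse_edgeK walk_marks_flip.
    by rewrite cyc_changes_negb mul2n addnn.
  by apply/allP => s; apply: goes_around_nondeg vE gE.
case/ext=> W [gW eW] /ext[W' [gW' eW']].
apply/eqP; rewrite -(eqn_pmul2l (isT : 0 < 2)) eW eW'; apply/eqP/eq_bigr => E vE.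
by rewrite (walk_marks_links ordL vE (gW' E vE) (gW E vE)).
Qed.

(** * Frame indices as numbers of marks *)

Section Degrees.
Context (L : link_graph T) (linkL : is_link_graph L).

Lemma mem_edge_mate x : (edge_mate x \in gedges L) = (x \in gedges L).
Proof.
have [_ _ _ closed _] := linkL.
suff h u : u \in gedges L -> edge_mate u \in gedges L.
  by apply/idP/idP => /h //; rewrite edge_mateK.
case: u => [[t i] k]; rewrite /edge_mate.
case: nbrP => [t' p _ _ _ e|_ _]; last by rewrite !perm1.
by apply: closed; rewrite /edge_adj /across e.
Qed.

Definition swap_face s : hflag T := (s.1.1, s.2, s.1.2).

Lemma swap_faceK : involutive swap_face.
Proof. by case=> [[[t i] j] k]. Qed.

Lemma half_mate_swap s : half_mate (swap_face s) = swap_face (cross s).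
Proof. by case: s => [[[t i] j] k]; rewrite /half_mate /cross /swap_face /=; case: nbr. Qed.

Lemma halves_uniq h : h \in halves L -> uniq [:: h.1.1.2; h.1.2; h.2].
Proof.
have [_ nd _ _ _] := linkL; rewrite inE => /andP[/nd].
by rewrite /= !inE !negb_or !(eq_sym h.2) andbT => -> /andP[-> ->].
Qed.

Lemma halvesE h : (h \in halves L) = (h.1 \in gedges L) && nondeg (swap_face h).
Proof.
have [_ nd _ _ _] := linkL.
rewrite inE nondegE; case: (boolP (h.1 \in _)) => // /nd ik.
rewrite /= !inE !negb_or (eq_sym h.2 h.1.1.2) (eq_sym h.2 h.1.2).
by rewrite (eq_sym h.1.2 h.1.1.2) ik.
Qed.

(** The frame index as a function of the link vertex instead of a representative. *)
Definition degree E : nat :=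
  #|[set class (@half_adj T) h | h in halves L & half_end h \in E]|.

Lemma frame_indexE x : frame_index L x = degree (class (@vertex_adj T) x).
Proof.
by apply: eq_card => C; apply/imsetP/imsetP => -[h hh ->]; exists h => //;
  move: hh; rewrite !inE.
Qed.

Section Marks.
Context (ord : tet T -> 'I_4 -> seq 'I_4).
Hypothesis ordL : is_face_order L ord.

(** In the state (t, i, j, k) a side marked [false] cuts off the corner at i, so only the frame edge
    (t, i, k) can give one. *)
Lemma count_side_marks s : nondeg s ->
  count_mem false (side_marks ord s) = ((swap_face s).1 \in gedges L).
Proof.
case: s => [[[t i] j] k]; rewrite nondegE /= => /andP[ij _].
have [ordu ordE _] := ordL.
rewrite -ordE -(count_uniq_mem _ (ordu t k)) count_map count_filter.
apply: eq_count => a /=; rewrite !inE eqbF_neg.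
by case: eqVneq => [->|_]; rewrite /= ?orbF // eq_sym (negPf ij).
Qed.

(** Sending a crossing of the walk to the class of its half is a bijection onto the frame ends at
    [E]. It is injective because [w] never contains both [s] and [cross s], and surjective because
    it contains one of them. *)
Lemma count_minus E w : E \in link_vertices T -> goes_around E w ->
  count_mem false (walk_marks ord w) = degree E.
Proof.
move=> vE gw; have uw : uniq w by case: gw.
have nw := goes_around_nondeg vE gw.
pose w0 := [seq s <- w | (swap_face s).1 \in gedges L].
have -> : count_mem false (walk_marks ord w) = size w0.
  rewrite /walk_marks count_flatten -map_comp size_filter -sumn_count.
  congr sumn; apply/eq_in_map => s /nw ns /=; exact: count_side_marks.
have <- : #|[set s in w0]| = size w0 by rewrite cardsE (card_uniqP _) // filter_uniq.
rewrite /degree -(card_in_imset (f := fun s => class (@half_adj T) (swap_face s))); last first.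
  move=> s s'; rewrite !inE !mem_filter => /andP[_ sw] /andP[_ sw'] /eqP.
  rewrite class_eq; last exact: half_adj_sym.
  rewrite connect_half_adj half_mate_swap !(inj_eq (can_inj swap_faceK)).
  case/predU1P=> [//|/eqP s'E]; move: sw'; rewrite s'E.
  have sE : s.1 \in E by case: gw => _ _ /(_ s sw)/andP[].
  by have [_ ->] := goes_around_mem vE gw sE (nw s sw); rewrite sw.
congr #|pred_of_set _|; apply/setP => C; apply/imsetP/imsetP => -[].
  move=> s; rewrite inE mem_filter => /andP[sL sw] ->.
  exists (swap_face s) => //; rewrite inE halvesE swap_faceK sL nw //=.
  by case: gw => _ _ /(_ s sw)/andP[]; rewrite /half_end /=; case: (s.1) => [[]].
move=> h; rewrite inE halvesE => /andP[/andP[hL nh] hE] ->.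
have sE : (swap_face h).1 \in E by [].
have [_] := goes_around_mem vE gw sE nh.
case: (boolP (swap_face h \in w)) => [sw _|_ sw].
  by exists (swap_face h); rewrite ?swap_faceK // inE mem_filter swap_faceK hL.
(* The walk crosses this incidence in the other direction, where the mate of [h] represents the same
   class. *)
exists (cross (swap_face h)).
  by rewrite inE mem_filter sw -half_mate_swap swap_faceK half_mate_edge mem_edge_mate hL.
apply/eqP; rewrite -half_mate_swap swap_faceK class_eq; last exact: half_adj_sym.
by rewrite connect_half_adj eqxx orbT.
Qed.

Lemma count_plus E w : E \in link_vertices T -> goes_around E w ->
  count_mem true (walk_marks ord w) = degree (reverse_edge E).
Proof.
move=> vE gw; rewrite -(count_minus _ (goes_around_flip gw)) ?reverse_link_vertex //.
rewrite walk_marks_flip; last by apply/allP => s; apply: goes_around_nondeg vE gw.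
by rewrite count_map; apply: eq_count => -[].
Qed.

(* A vertex of degree 1 would leave a polygon with a single side of one mark,
   which has no decomposition into basic configurations. *)
Lemma decomposition_cones E w ps : E \in link_vertices T -> goes_around E w ->
  is_decomposition (config_polygon ord w) ps ->
  [/\ degree E != 1, degree (reverse_edge E) != 1
    & cone_cells ps = (degree E - 2) + (degree (reverse_edge E) - 2)].
Proof.
move=> vE gw; rewrite -(count_minus vE gw) -(count_plus vE gw) -!mark_config_polygon.
case: (config_polygon _ _) => [|a P]; first by move=> /= ->; rewrite /cone_cells big_nil.
case=> -[n dP] bps.
have h1 := decomposes_count true dP isT bps; have h2 := decomposes_count false dP isT bps.
split=> //; have := decomposes_cones dP isT bps.
rewrite -(size_map (@mark T)); move: h1 h2; move: (map _ _) (cone_cells _) => m c.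
have memE e : (e \in m) = (0 < count_mem e m) by rewrite -has_pred1 has_count.
rewrite !memE.
have -> : size m = count_mem true m + count_mem false m.
  by rewrite -(count_predC (pred1 true)); congr (_ + _); apply: eq_count => -[].
by move: (count_mem true m) (count_mem false m) => [|[|x]] [|[|y]] //= _ _; lia.
Qed.

End Marks.
End Degrees.

End Walks.

(** * Branches and branch points *)

Section Dihedral.
Context (A : finType) (alpha beta : A -> A) (x : A).
Hypotheses (alphaK : involutive alpha) (betaK : involutive beta) (bx : beta x = x).
Let f := beta \o alpha.

Lemma dihedral_inj : injective f.
Proof. exact: inj_comp (can_inj betaK) (can_inj alphaK). Qed.

Lemma dihedral_iter_beta n : iter n f (beta (iter n f x)) = x.
Proof.
elim: n => // n IHn; rewrite iterSr iterS.
by have -> : f (beta (f (iter n f x))) = beta (iter n f x) by rewrite /f /= betaK alphaK.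
Qed.

Lemma dihedral_iter_alpha n : iter n.+1 f (alpha (iter n f x)) = x.
Proof.
elim: n => [|n IHn]; first by rewrite /= /f /= alphaK.
rewrite iterSr iterS.
by have -> : f (alpha (f (iter n f x))) = alpha (iter n f x) by rewrite /f /= alphaK betaK.
Qed.

(** An iterate of [f] takes [beta y] back to [x], and connection under an injective map of a finite
    type is symmetric. *)
Lemma dihedral_beta y : fconnect f x y -> fconnect f x (beta y).
Proof.
move/iter_findex => <-; rewrite (fconnect_sym dihedral_inj).
by rewrite -[X in connect _ _ X](dihedral_iter_beta (findex f x y)) fconnect_iter.
Qed.

Lemma dihedral_alpha y : fconnect f x y -> fconnect f x (alpha y).
Proof.
move/iter_findex => <-; rewrite (fconnect_sym dihedral_inj).
by rewrite -[X in connect _ _ X](dihedral_iter_alpha (findex f x y)) fconnect_iter.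
Qed.

(* On the orbit of [x], indexed by Z/N with [x] at 0, [beta] is n |-> -n and
   [alpha] is n |-> -n-1. As [alpha] has no fixed point, N is even, so [beta]
   fixes exactly 0 and N/2. *)
Lemma dihedral_fixpoints : (forall y, fconnect f x y -> alpha y != y) ->
  #|[set y | fconnect f x y & beta y == y]| = 2.
Proof.
move=> nfix; set N := fingraph.order f x.
have N0 : 0 < N by exact: order_gt0.
have iN m : iter (m * N) f x = x.
  by elim: m => // m IHm; rewrite mulSn iterD IHm (iter_order dihedral_inj).
have iN1 : iter N f x = x by have := iN 1; rewrite mul1n.
have inj_iter n : injective (iter n f).
  by elim: n => // n IHn a b; rewrite !iterS => /dihedral_inj/IHn.
have fix_dvd n : (iter n f x == x) = (N %| n).
  rewrite {1}(divn_eq n N) addnC iterD iN /dvdn.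
  have lt := ltn_pmod n N0; apply/eqP/eqP => [e|->] //.
  by rewrite -(findex_iter lt) e findex0.
have evenN : ~~ odd N.
  (* If N = 2q + 1, then -q - 1 = q modulo N, and [alpha] would fix the point with index q. *)
  apply/negP => oN; have /negP := nfix (iter N./2 f x) (fconnect_iter _ _ _); apply.
  apply/eqP/(inj_iter N./2.+1); rewrite dihedral_iter_alpha -iterD addSn addnn.
  by have -> : N./2.*2.+1 = N; [rewrite -[RHS]odd_double_half oN|rewrite iN1].
have N2 : N = N./2.*2 by rewrite -{1}(odd_double_half N) (negPf evenN).
have h0 : 0 < N./2 by move: N0; rewrite {1}N2; case: N./2.
have lth : N./2 < N by rewrite {2}N2 -addnn -{1}(addn0 N./2) ltn_add2l.
have -> : [set y | fconnect f x y & beta y == y] = [set x; iter N./2 f x].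
  apply/setP => y; rewrite !inE; apply/andP/orP => [[xy /eqP yb]|[/eqP ->|/eqP ->]].
  - have lt := findex_max xy; move: yb (iter_findex xy).
    set n := findex f x y in lt *; move=> + ny; rewrite -ny => yb.
    have : N %| n + n by rewrite -fix_dvd iterD -{1}yb dihedral_iter_beta.
    (* As n < N, the quotient of n + n by N is 0 or 1, giving n = 0 or n = N/2. *)
    case/dvdnP=> -[|[|q]]; rewrite -/N in lt.
    + by move/eqP; rewrite addn_eq0 => /andP[/eqP -> _]; left.
    + by rewrite mul1n N2 addnn => /double_inj ->; right; rewrite doubleK.
    + move=> e; have : 2 * N <= n + n by rewrite e leq_mul2r orbT.
      by rewrite mul2n -addnn leqNgt -addSn leq_add // ltnW.
  - by rewrite bx connect0.
  - rewrite fconnect_iter; split=> //.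
    apply/eqP/(inj_iter N./2); rewrite dihedral_iter_beta -iterD addnn -N2.
    by rewrite iN1.
by rewrite cards2 eq_sym fix_dvd gtnNdvd.
Qed.

End Dihedral.

(** * Ends of frame edges and the strands joining them *)

Section Branches.
Context (T : gluing) (L : link_graph T) (linkL : is_link_graph L).
Implicit Types (h : hflag T) (x : flag T) (C : {set hflag T}).

Definition ends : {set {set hflag T}} := [set class (@half_adj T) h | h in halves L].

Lemma half_mate_halves h : (half_mate h \in halves L) = (h \in halves L).
Proof.
rewrite !(halvesE linkL) half_mate_edge mem_edge_mate //; congr (_ && _).
by rewrite -{1}(swap_faceK h) half_mate_swap swap_faceK nondeg_cross.
Qed.

Lemma class_half h h' : class (@half_adj T) h = class (@half_adj T) h' ->
  h' = h \/ h' = half_mate h.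
Proof.
move/eqP; rewrite class_eq; last exact: half_adj_sym.
by rewrite connect_half_adj => /predU1P[|/eqP]; [left|right].
Qed.

Lemma class_half_mate h : class (@half_adj T) (half_mate h) = class (@half_adj T) h.
Proof.
by apply: class_connect; rewrite ?connect_half_adj ?eqxx ?orbT //; exact: half_adj_sym.
Qed.

Lemma mem_class_half h h' :
  (h' \in class (@half_adj T) h) = (h' == h) || (h' == half_mate h).
Proof. by rewrite mem_class connect_half_adj. Qed.

(** The union avoids choosing a half in [C]: for an end, all its members are the same class. *)
Definition end_vertex C : {set flag T} :=
  \bigcup_(h in C) class (@vertex_adj T) (half_end h).

Lemma end_vertex_class h : h \in halves L ->
  end_vertex (class (@half_adj T) h) = class (@vertex_adj T) (half_end h).
Proof.
move=> hL; have hu := halves_uniq linkL hL.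
apply/setP => y; apply/bigcupP/idP => [[h']|yh]; last first.
  by exists h; rewrite // mem_class_half eqxx.
rewrite mem_class_half => /predU1P[->//|/eqP ->].
by rewrite (class_connect (@vertex_adj_sym T) (half_mate_end hu)).
Qed.

Lemma end_vertex_link C : C \in ends -> end_vertex C \in link_vertices T.
Proof.
case/imsetP=> h hL ->; rewrite end_vertex_class // imset_f // inE.
by have := halves_uniq linkL hL; rewrite /= !inE !negb_or => /andP[/andP[]].
Qed.

Lemma degree_ends V : V \in link_vertices T ->
  degree L V = #|[set C in ends | end_vertex C == V]|.
Proof.
move=> vV; apply: eq_card => C; rewrite inE; apply/imsetP/andP => [[h]|[/imsetP[h hL ->]]].
  rewrite inE => /andP[hL hV] ->; rewrite imset_f // end_vertex_class //.
  by rewrite (link_vertex_class vV hV).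
by rewrite end_vertex_class // => /eqP <-; exists h; rewrite // inE hL mem_class connect0.
Qed.

Definition is_branching C : bool := 2 < degree L (end_vertex C).

Lemma is_branchingE h : h \in halves L ->
  is_branching (class (@half_adj T) h) = branch_point L (half_end h).
Proof.
have [_ _ _ _ endL] := linkL => hL.
rewrite /is_branching end_vertex_class // /branch_point frame_indexE.
suff -> : half_end h \in gverts L by [].
by move: hL; case: h => [[[t i] k] j]; rewrite inE => /andP[/endL h /h].
Qed.

(** The half at the other end of the same link edge. Degenerate tuples are fixed, to have an
    involution everywhere. *)
Definition half_opp h : hflag T := if nondeg h then turn h else h.

Lemma half_oppK : involutive half_opp.
Proof.
move=> h; rewrite /half_opp; case: (boolP (nondeg h)) => [nh|/negPf ->] //.
by rewrite nondeg_turn // turnK.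
Qed.

Lemma half_opp_mate h : half_opp (half_mate h) = half_mate (half_opp h).
Proof.
have e : nondeg (half_mate h) = nondeg h.
  case: h => [[[t i] k] j]; rewrite /nondeg /half_mate; case: (nbr t k) => t' p.
  exact: (map_inj_uniq (@perm_inj _ p) [:: i; k; j]).
rewrite /half_opp e; case: ifP => //.
case: h {e} => [[[t i] k] j]; rewrite /nondeg /turn /half_mate; case: (nbr t k) => t' p.
move=> nh; congr (_, _); apply: rest_unique.
by rewrite (map_inj_uniq (@perm_inj _ p) [:: i; k; j; rest [:: i; k; j]]) rest_uniq.
Qed.

Lemma half_opp_halves h : h \in halves L -> half_opp h \in halves L.
Proof.
move=> hL; have nh : nondeg h := halves_uniq linkL hL.
have := nondeg_turn nh; rewrite /half_opp nh; move: hL.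
case: h {nh} => [[[t i] k] j]; rewrite !inE /turn /nondeg => /andP[-> _].
by rewrite /= !inE !negb_or !(eq_sym (rest _)) andbT => /andP[/andP[_ ->] ->].
Qed.

Lemma half_opp_edge h : (half_opp h).1 = h.1.
Proof. by rewrite /half_opp; case: ifP => // _; case: h => [[[t i] k] j]. Qed.

Lemma halves_same_edge h h' : h \in halves L -> h' \in halves L -> h'.1 = h.1 ->
  h' = h \/ h' = half_opp h.
Proof.
move=> hL hL' e; have nh : nondeg h := halves_uniq linkL hL.
have nh' : nondeg h' := halves_uniq linkL hL'.
case: (h' =P h) => [|/eqP ne]; [by left|right]; rewrite /half_opp nh.
case: h h' nh nh' e ne {hL hL'} => [x j] [x' j'] /= nh nh' e; rewrite -{}e in nh *.
case: x' nh nh' => [[t i] k]; rewrite /nondeg /= => nh nh' ne; congr (_, _).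
apply/esym/rest_unique.
have jj' : j != j' by apply: contraNneq ne => ->.
move: nh nh'; rewrite /= !inE !negb_or !andbT jj' => /andP[/andP[-> ->] ->].
by case/andP=> /andP[_ ->] ->.
Qed.

Definition opposite_end C : {set hflag T} := half_opp @: C.

Lemma opposite_endK : involutive opposite_end.
Proof.
move=> C; rewrite /opposite_end -imset_comp -[RHS]imset_id.
by apply: eq_imset => h /=; exact: half_oppK.
Qed.

Lemma opposite_end_class h :
  opposite_end (class (@half_adj T) h) = class (@half_adj T) (half_opp h).
Proof.
apply/setP => h'; rewrite -{1}(half_oppK h') mem_imset; last exact: can_inj half_oppK.
by rewrite !mem_class_half -half_opp_mate !(canF_eq half_oppK).
Qed.

Lemma opposite_end_ends C : C \in ends -> opposite_end C \in ends.
Proof.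
case/imsetP=> h hL ->; rewrite opposite_end_class imset_f //; exact: half_opp_halves.
Qed.

(** The two halves of a link edge differ within a tetrahedron, and could be mates only through a
    face paired with itself, which [glue_neq] excludes. *)
Lemma opposite_end_neq C : C \in ends -> opposite_end C != C.
Proof.
case/imsetP=> h hL ->; have nh : nondeg h := halves_uniq linkL hL.
rewrite opposite_end_class eq_sym; apply/eqP => /class_half.
rewrite /half_opp nh; case: h nh {hL} => [[[t i] k] j]; rewrite /turn /nondeg /= => nh.
have rj : rest [:: i; k; j] != j.
  by have := rest_notin i k j; rewrite !inE !negb_or => /and3P[].
case=> [[] /eqP|]; first by rewrite (negPf rj).
case: nbrP => [t' p _ _ /eqP ne _ [e1 _ e2 _]|_ _]; first by case: ne; rewrite -e1 -e2.
by rewrite !perm1 => -[] /eqP; rewrite (negPf rj).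
Qed.

Definition adjacent_ends C C' : bool :=
  [&& C \in ends, C' \in ends, end_vertex C == end_vertex C', ~~ is_branching C & C' != C].

(** Continuation of the frame through a vertex that is not a branch point. The default [C] makes
    branching ends fixed points, so that the ends of branches appear as fixed points of an
    involution. *)
Definition next_end C : {set hflag T} := odflt C [pick C' | adjacent_ends C C'].

Lemma adjacent_ends_sym C C' : adjacent_ends C C' = adjacent_ends C' C.
Proof.
rewrite /adjacent_ends (eq_sym C) (eq_sym (end_vertex C)) /is_branching.
case: eqVneq => [->|_]; rewrite ?andbF //= !andbA; congr (_ && _ && _).
exact: andbC.
Qed.

(** Three distinct ends at one vertex would make it branching. *)
Lemma adjacent_ends_unique C C1 C2 : adjacent_ends C C1 -> adjacent_ends C C2 -> C1 = C2.
Proof.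
case/and5P=> eC eC1 /eqP v1 nb ne1 /and5P[_ eC2 /eqP v2 _ ne2].
apply/eqP; apply: contraR nb => ne12; rewrite /is_branching degree_ends ?end_vertex_link //.
have /card_uniqP u : uniq [:: C; C1; C2].
  by rewrite /= !inE !negb_or (eq_sym C) ne1 (eq_sym C) ne2 ne12.
rewrite -[_ < _]/(size [:: C; C1; C2] <= _) -u.
apply: subset_leq_card; apply/fintype.subsetP => D; rewrite !inE.
by case/or3P=> /eqP ->; rewrite ?eC ?eC1 ?eC2 -?v1 -?v2 eqxx.
Qed.

Lemma next_end_eq C C' : adjacent_ends C C' -> next_end C = C'.
Proof.
rewrite /next_end => a; case: pickP => [D d|/(_ C')]; last by rewrite a.
exact: adjacent_ends_unique d a.
Qed.

Variant next_end_spec C : {set hflag T} -> Prop :=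
| NextEnd C' of adjacent_ends C C' : next_end_spec C C'
| NoNextEnd of (forall C', adjacent_ends C C' = false) : next_end_spec C C.

Lemma next_endP C : next_end_spec C (next_end C).
Proof. by rewrite /next_end; case: pickP => [C' a|h] /=; [exact: NextEnd|exact: NoNextEnd]. Qed.

Lemma next_endK : involutive next_end.
Proof.
move=> C; case: (next_endP C) => [C'|h].
  by rewrite adjacent_ends_sym => /next_end_eq.
by case: (next_endP C) => // C'; rewrite h.
Qed.

Lemma next_end_ends C : C \in ends -> next_end C \in ends.
Proof. by case: next_endP => // C' /and5P[]. Qed.

(* A vertex of degree other than 1 has a second end unless it branches. *)
Lemma next_end_fix C : C \in ends -> degree L (end_vertex C) != 1 ->
  (next_end C == C) = is_branching C.
Proof.
move=> eC d1; case: next_endP => [C' /and5P[_ _ _ /negPf -> /negPf -> //]|none].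
rewrite eqxx; apply/esym; apply: contraT => nb.
have : 1 < degree L (end_vertex C).
  rewrite ltn_neqAle eq_sym d1 degree_ends ?end_vertex_link // card_gt0.
  by apply/set0Pn; exists C; rewrite inE eC eqxx.
rewrite degree_ends ?end_vertex_link // (cardsD1 C) inE eC eqxx ltnS card_gt0.
case/set0Pn=> C'; rewrite !inE => /and3P[ne eC' /eqP v].
by have := none C'; rewrite /adjacent_ends eC eC' v eqxx nb ne.
Qed.

Lemma strand_adj_sym : connect_sym (strand_adj L).
Proof.
apply: sym_connect_sym.
suff h x y : strand_adj L x y -> strand_adj L y x by move=> x y; apply/idP/idP => /h.
rewrite /strand_adj => /orP[|/exists_inP[h hL /exists_inP[h' hL' /and4P[/eqP <- /eqP <- c nb]]]].
  case: x => [[t i] k]; rewrite /edge_adj /across.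
  case E: (Defs.glue t k) => [[t' p]|//] /eqP ->.
  by rewrite (glueK E) !permK eqxx.
apply/orP; right; apply/exists_inP; exists h' => //; apply/exists_inP; exists h => //.
have e : is_branching (class (@half_adj T) h') = is_branching (class (@half_adj T) h).
  by rewrite /is_branching !end_vertex_class // (class_connect (@vertex_adj_sym T) c).
by rewrite !eqxx vertex_adj_sym c -is_branchingE // e is_branchingE.
Qed.

Definition end_strand C : {set flag T} := \bigcup_(h in C) strand L h.1.

Lemma strand_connect x y : connect (strand_adj L) x y -> strand L y = strand L x.
Proof. exact/class_connect/strand_adj_sym. Qed.

Lemma strand_edge_mate x : strand L (edge_mate x) = strand L x.
Proof.
apply: strand_connect; apply: (@connect_sub _ (@edge_adj T)).
  by move=> u v uv; apply: connect1; rewrite /strand_adj uv.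
by rewrite connect_edge_adj eqxx orbT.
Qed.

Lemma end_strand_class h : end_strand (class (@half_adj T) h) = strand L h.1.
Proof.
apply/setP => y; apply/bigcupP/idP => [[h']|yh]; last first.
  by exists h; rewrite // mem_class_half eqxx.
by rewrite mem_class_half => /predU1P[->//|/eqP ->]; rewrite half_mate_edge strand_edge_mate.
Qed.

Lemma end_strand_opposite C : C \in ends -> end_strand (opposite_end C) = end_strand C.
Proof.
by case/imsetP=> h hL ->; rewrite opposite_end_class !end_strand_class half_opp_edge.
Qed.

Lemma end_strand_next C : end_strand (next_end C) = end_strand C.
Proof.
case: next_endP => // C' /and5P[/imsetP[h hL ->] /imsetP[h' hL' ->]].
rewrite !end_vertex_class // class_eq; last exact: vertex_adj_sym.
move=> c; rewrite is_branchingE // => nb _; rewrite !end_strand_class.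
apply/strand_connect/connect1; apply/orP; right; apply/exists_inP; exists h => //.
by apply/exists_inP; exists h' => //; rewrite !eqxx c nb.
Qed.

(** [opposite_end] and [next_end] generate a dihedral action on the ends. The orbit of a branching
    end consists of all ends on its strand, and the branching ones among them are the fixed points
    of [next_end], of which [dihedral_fixpoints] gives two. *)
Lemma strand_fiber h0 : (forall V, V \in link_vertices T -> degree L V != 1) ->
  h0 \in halves L -> branch_point L (half_end h0) ->
  #|[set C in ends | is_branching C & end_strand C == strand L h0.1]| = 2.
Proof.
move=> d1 hL0 b0; pose C0 := class (@half_adj T) h0.
have eC0 : C0 \in ends by exact: imset_f.
have fixC C : C \in ends -> (next_end C == C) = is_branching C.
  by move=> eC; apply: next_end_fix => //; apply/d1/end_vertex_link.
have fix0 : next_end C0 = C0 by apply/eqP; rewrite fixC // is_branchingE.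
pose f := next_end \o opposite_end.
have orb C : fconnect f C0 C -> C \in ends /\ end_strand C = strand L h0.1.
  move/iter_findex => <-; elim: (findex _ _ _) => [|n [en sn]] /=.
    by rewrite end_strand_class.
  by rewrite next_end_ends ?opposite_end_ends // end_strand_next end_strand_opposite.
have two := dihedral_fixpoints opposite_endK next_endK fix0.
apply: etrans (two _); last by move=> C /orb[eC _]; exact: opposite_end_neq.
apply: eq_card => C; rewrite !inE.
apply/and3P/andP => [[eC bC /eqP sC]|[/[dup] /orb[eC ->]]]; last first.
  by rewrite eqxx fixC.
split; last by rewrite fixC.
case/imsetP: eC sC {bC} => h hL ->; rewrite end_strand_class => sh.
(* With one end of a frame edge, the orbit contains the other one too. *)
have same u v : u \in halves L -> v \in halves L -> v.1 = u.1 ->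
    fconnect f C0 (class (@half_adj T) u) -> fconnect f C0 (class (@half_adj T) v).
  move=> uL vL e c; have [->//|->] := halves_same_edge uL vL e.
  by rewrite -opposite_end_class; apply: dihedral_alpha; [exact: opposite_endK|exact: next_endK|..].
have : connect (strand_adj L) h0.1 h.1
  by rewrite -mem_class -/(strand L h0.1) -sh mem_class connect0.
case/connectP=> p pp eh.
(* The property carried along the path from [h0.1] to [h.1] is that all ends of the current frame
   edge lie in the orbit. *)
have : forall u, u \in halves L -> u.1 = h0.1 -> fconnect f C0 (class (@half_adj T) u).
  by move=> u uL e; apply: same e _ => //; exact: connect0.
elim: p (h0.1) pp eh => [|z p IHp] x /= => [_ hx|/andP[xz pp] eh] hyp; first exact: hyp.
apply: (IHp z) => // u uL uz; case/orP: xz => [xz|].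
  (* The alternative x = z would pair a face with itself. *)
  have e : x = edge_mate z.
    have := connect1 xz; rewrite edge_adj_sym connect_edge_adj => /predU1P[e|/eqP //].
    move: xz; rewrite e; case: (z) => [[t i] k]; rewrite /edge_adj /across.
    by case E: (Defs.glue t k) => [[t' q]|//] /eqP[e1 _ e2];
      have := glue_neq E; rewrite -e1 -e2 eqxx.
  rewrite -class_half_mate; apply: hyp; first by rewrite half_mate_halves.
  by rewrite half_mate_edge uz e.
case/exists_inP=> v vL /exists_inP[v' vL' /and4P[/eqP vx /eqP vz c nb]].
apply: (same v') => //; first by rewrite uz vz.
have := hyp v vL vx; case: (eqVneq (class (@half_adj T) v') (class (@half_adj T) v)) => [->//|ne].
have -> : class (@half_adj T) v' = next_end (class (@half_adj T) v).
  apply/esym/next_end_eq; rewrite /adjacent_ends !imset_f // ne is_branchingE // nb.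
  by rewrite !end_vertex_class // class_eq ?c //; exact: vertex_adj_sym.
by apply: dihedral_beta; [exact: opposite_endK|exact: next_endK|..].
Qed.

(** Double count of the branching ends: grouped by vertex they give the degrees, grouped by strand
    they give two for each branch. *)
Lemma sum_branch_degrees : (forall V, V \in link_vertices T -> degree L V != 1) ->
  \sum_(V in link_vertices T | 2 < degree L V) degree L V = 2 * num_branches L.
Proof.
move=> d1; pose B := [set C in ends | is_branching C].
transitivity #|B|.
  rewrite -sum1_card (partition_big end_vertex
    (fun V => (V \in link_vertices T) && (2 < degree L V))) /=; last first.
    by move=> C; rewrite inE => /andP[/end_vertex_link v b]; rewrite v.
  apply: eq_bigr => V /andP[vV dV]; rewrite degree_ends // -sum1_card.
  apply: eq_bigl => C; rewrite !inE -andbA; congr (_ && _).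
  by rewrite /is_branching; case: eqVneq => [->|]; rewrite ?dV ?andbF.
pose S := [set strand L x | x in gedges L & is_arc L (strand L x)].
rewrite -sum1_card (partition_big end_strand (mem S)) /=; last first.
  move=> C; rewrite inE => /andP[/imsetP[h hL ->]]; rewrite is_branchingE // => bh.
  rewrite end_strand_class; apply/imsetP; exists h.1 => //; rewrite inE.
  have /andP[-> _] : (h.1 \in gedges L) && true by move: hL; rewrite inE => /andP[->].
  by apply/exists_inP; exists h; rewrite // bh mem_class connect0.
transitivity (\sum_(V in S) 2); last by rewrite sum_nat_const mulnC.
apply: eq_bigr => V /imsetP[x]; rewrite inE => /andP[xL /exists_inP[h0 hL0 /andP[h0x b0]]] ->.
apply: etrans (strand_fiber d1 hL0 b0); rewrite -sum1_card; apply: eq_bigl => C.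
by rewrite !inE -andbA (@strand_connect x h0.1) // -mem_class.
Qed.

Lemma num_branch_pointsE :
  num_branch_points L = #|[set V in link_vertices T | 2 < degree L V]|.
Proof.
have [nd _ _ _ endL] := linkL.
apply: eq_card => V; rewrite inE; apply/imsetP/andP => [[v]|[vV dV]].
  rewrite inE => /andP[vL /andP[_ dv]] ->; rewrite -frame_indexE; split=> //.
  by rewrite imset_f // inE nd.
have : 0 < degree L V by exact: ltnW (ltnW dV).
rewrite card_gt0 => /set0Pn[C /imsetP[h + _]]; rewrite inE => /andP[hL hV].
have vL : half_end h \in gverts L.
  by move: hL; case: h {hV} => [[[t i] k] j]; rewrite inE => /andP[/endL h /h].
exists (half_end h); last exact: link_vertex_class vV hV.
by rewrite inE /branch_point vL frame_indexE -(link_vertex_class vV hV).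
Qed.

(** Vertices of degree at most 2 vanish by truncated subtraction, and each branch point restores its
    missing 2. *)
Lemma sum_excess_degrees : (forall V, V \in link_vertices T -> degree L V != 1) ->
  \sum_(V in link_vertices T) (degree L V - 2) + 2 * num_branch_points L
  = 2 * num_branches L.
Proof.
move=> d1; rewrite -sum_branch_degrees // num_branch_pointsE.
rewrite (bigID (fun V => 2 < degree L V)) /= [X in _ + X + _]big1 ?addn0; last first.
  by move=> V /andP[_]; rewrite -leqNgt => h; apply/eqP.
rewrite mulnC -sum_nat_const; under [X in _ + X]eq_bigl do rewrite inE.
by rewrite -big_split /=; apply: eq_bigr => V /andP[_ /ltnW h]; rewrite subnK.
Qed.

End Branches.

(** * Counting the tetrahedra *)

(** The conditions are local: each can be checked in the frame on the surface through the corner of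
    the flag concerned. *)
Lemma frame_collection_link_graph (R : realType) (T : gluing) (L : link_graph T) :
  is_frame_collection R L -> is_link_graph L.
Proof.
move=> fL; have lg c : is_link_graph (graph_at c L) by case: (fL c) => -[].
have inV x : (x \in gverts (graph_at x.1 L)) = (x \in gverts L).
  by rewrite inE connect0 andbT.
have inE' x : (x \in gedges (graph_at x.1 L)) = (x \in gedges L).
  by rewrite inE connect0 andbT.
split.
- by move=> x; rewrite -inV => xV; case: (lg x.1) => + _ _ _ _; apply.
- by move=> x; rewrite -inE' => xE; case: (lg x.1) => _ + _ _ _; apply.
- move=> x y xy; rewrite -inV => xV; case: (lg x.1) => _ _ /(_ _ _ xy xV) + _ _.
  by rewrite inE => /andP[].
- move=> x y xy; rewrite -inE' => xE; case: (lg x.1) => _ _ _ /(_ _ _ xy xE) + _.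
  by rewrite inE => /andP[].
move=> t i k j; rewrite -inE' => xE hj; case: (lg (t, i)) => _ _ _ _ /(_ _ _ _ _ xE hj).
by rewrite inE => /andP[].
Qed.

(** * Enumeration of the cells *)

Section Cells.
Context (T : gluing) (L : link_graph T) (D : inflation_data T).

Definition piece_cells (E : {set flag T}) (p : nat) : nat :=
  if onth (pieces D E) p is Some Q then
    if is_crossing Q then 1 else if is_branch Q then size (subdiv D E p) else 0
  else 0.

(** Codes lie in a type with decidable equality, so the used cells can be listed and counted. *)
Definition cell_code (c : cell T) :
    tet T + {set flag T} + {set flag T} * (nat * nat) :=
  match c with
  | Old t => inl (inl t)
  | Infl x => inl (inr x)
  | Added E p q => inr (E, (p, q))
  end.

Lemma cell_code_inj : injective cell_code.
Proof. by case=> [t|x|E p q] [t'|x'|E' p' q'] //= []; congruence. Qed.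

Definition added_codes : seq ({set flag T} * (nat * nat)) :=
  [seq (E, pq) | E <- enum (edges (edge_dir D)),
    pq <- [seq (p, q) | p <- iota 0 (size (pieces D E)), q <- iota 0 (piece_cells E p)]].

Definition used_codes : seq (tet T + {set flag T} + {set flag T} * (nat * nat)) :=
  map inl (map inl (enum (tet T)) ++
           map inr (enum [set class (@edge_adj T) x | x in gedges L]))
  ++ map inr added_codes.

Lemma inl_inj A B : injective (@inl A B). Proof. by move=> ? ? []. Qed.
Lemma inr_inj A B : injective (@inr A B). Proof. by move=> ? ? []. Qed.

Lemma used_codes_uniq : uniq used_codes.
Proof.
have dis (A B : eqType) (s : seq A) (t : seq B) : ~~ has [in map inl s] (map inr t).
  by apply/hasPn => _ /mapP[b _ ->]; apply/mapP => -[].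
have uA : uniq added_codes.
  rewrite allpairs_uniq_dep ?enum_uniq //.
    move=> E _; rewrite allpairs_uniq_dep ?iota_uniq //.
      by move=> p _; exact: iota_uniq.
    by move=> [p q] [p' q'] _ _ /= [-> ->].
  by move=> [E u] [E' u'] _ _ /= [-> ->].
rewrite /used_codes cat_uniq dis (map_inj_uniq (@inl_inj _ _)) (map_inj_uniq (@inr_inj _ _)).
rewrite cat_uniq dis (map_inj_uniq (@inl_inj _ _)) (map_inj_uniq (@inr_inj _ _)).
by rewrite !enum_uniq uA.
Qed.

Lemma onth_size A (s : seq A) n x : onth s n = Some x -> n < size s.
Proof. by move=> e; rewrite -onthTE e. Qed.

Lemma mem_used_codes c : used_cell L D c <-> cell_code c \in used_codes.
Proof.
have no (A B : eqType) (s : seq A) (b : B) : (inr b : A + B) \in map inl s = false.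
  by apply/mapP => -[].
have no' (A B : eqType) (s : seq B) (a : A) : (inl a : A + B) \in map inr s = false.
  by apply/mapP => -[].
have ml (A B : eqType) (s : seq A) (a : A) : (inl a : A + B) \in map inl s = (a \in s).
  by rewrite mem_map //; exact: inl_inj.
have mr (A B : eqType) (s : seq B) (b : B) : (inr b : A + B) \in map inr s = (b \in s).
  by rewrite mem_map //; exact: inr_inj.
have added E p q : (inr (E, (p, q)) \in used_codes) =
    [&& E \in edges (edge_dir D), p < size (pieces D E) & q < piece_cells E p].
  rewrite /used_codes mem_cat no mr /=; apply/allpairsPdep/and3P.
    case=> E' [u [eE /allpairsPdep[p' [q' [pE qE ->]]] [-> -> ->]]].
    by move: eE pE qE; rewrite mem_enum !mem_iota.
  move=> [eE pE qE]; exists E, (p, q); split=> //; first by rewrite mem_enum.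
  by apply/allpairsPdep; exists p, q; rewrite !mem_iota.
split=> [[t|x xL|E p Q eE pQ cQ|E p Q q eE pQ bQ qs]|].
- by rewrite /used_codes mem_cat no' orbF ml mem_cat no' orbF ml mem_enum.
- by rewrite /used_codes mem_cat no' orbF ml mem_cat no /= mr mem_enum imset_f.
- by rewrite added eE (onth_size pQ) /piece_cells pQ cQ.
- by rewrite added eE (onth_size pQ) /piece_cells pQ is_branch_crossing // bQ.
case: c => [t _|x|E p q]; first exact: used_old.
  rewrite /used_codes mem_cat no' orbF ml mem_cat no /= mr mem_enum.
  by case/imsetP=> y yL ->; exact: used_frame.
rewrite /= added => /and3P[eE _]; rewrite /piece_cells.
case pQ: (onth _ _) => [Q|//]; case: ifP => cQ.
  by case: q => // _; exact: used_crossing pQ cQ.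
by case: ifP => // bQ; exact: used_cone pQ bQ.
Qed.

Lemma size_used_codes : are_choices L D ->
  size used_codes = #|tet T| + num_edges L
    + \sum_(E in edges (edge_dir D)) (count (@is_crossing T) (pieces D E)
                                      + cone_cells (pieces D E)).
Proof.
case=> _ _ _ _ sub; rewrite size_cat !size_map size_cat !size_map; congr (_ + _).
  by rewrite cardT enumT /num_edges cardE.
rewrite /added_codes size_allpairs_dep sumnE big_map big_enum /=; apply: eq_bigr => E eE.
rewrite size_allpairs_dep; under eq_map do rewrite size_iota.
(* A polygon is never both a crossing and a branch, so the nested conditionals of [piece_cells]
   become a sum. *)
pose cells (Q : seq (side T)) := is_crossing Q + (if is_branch Q then size Q - 2 else 0).
transitivity (\sum_(Q <- pieces D E) cells Q); last first.
  rewrite big_split; congr (_ + _); last by rewrite /cone_cells [RHS]big_mkcond.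
  by rewrite -sum1_count [RHS]big_mkcond; apply: eq_bigr => Q _; case: is_crossing.
rewrite sumnE big_map -[X in iota 0 X]subn0 -/(index_iota _ _) (big_nth [::]).
apply: eq_big_nat => p /andP[_ ps].
have pQ : onth (pieces D E) p = Some (nth [::] (pieces D E) p).
  by rewrite onthE (nth_map [::]).
rewrite /piece_cells pQ /cells; case: ifP => cQ.
  by case: ifP => // /is_branch_crossing; rewrite cQ.
case: ifP => // bQ.
by rewrite -[in RHS](size_iota 0 (size _)) -(polygon_subdiv_size (sub E p _ eE pQ bQ)) addnK.
Qed.

End Cells.

Theorem theorem4p4 (R : realType) (X : topologicalType) (T : gluing)
    (L : link_graph T) (D : inflation_data T) (T' : gluing)
    (HX : compact_3manifold R X)
    (HS : no_sphere_boundary R X)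
    (HT : ideal_triangulation R T X)
    (HL : is_frame_collection R L)
    (HD : is_inflation L D R T')
    (Hcross : has_crossings (face_order D) (crossing_number L)) :
  (#|tet T'|%:Z = #|tet T|%:Z + complexity L)%R.
Proof.
have linkL := frame_collection_link_graph HL.
case: HD => _ choices [name [name_inj used _]].
have [_ _ ordL config _] := choices; have [dpos hE] := config.
have cones E : E \in edges (edge_dir D) -> _ :=
  fun eE => decomposition_cones linkL ordL (edges_link_vertices eE) (hE E eE).1 (hE E eE).2.
(* Each link vertex is a directed edge of [edges (edge_dir D)] or the reverse of one, so
   [decomposition_cones] covers both ends. *)
have deg1 V : V \in link_vertices T -> degree L V != 1.
  move=> vV; case: (boolP (V \in edges (edge_dir D))) => [/cones[]//|].
  by rewrite -reverse_edges // => /cones[_]; rewrite reverse_edgeK.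
(* For the fixed face orders the number of crossings is independent of directions, walks and
   decompositions, so this family realizes the minimum as well. *)
have crossings : \sum_(E in edges (edge_dir D)) count (@is_crossing T) (pieces D E)
    = crossing_number L.
  by apply: has_crossings_unique ordL _ Hcross; exists (edge_dir D), (walk D), (pieces D).
have cone_total : \sum_(E in edges (edge_dir D)) cone_cells (pieces D E)
    = \sum_(V in link_vertices T) (degree L V - 2).
  by rewrite -(sum_link_vertices dpos); apply: eq_bigr => E /cones[].
(* The names put the tetrahedra in bijection with the duplicate-free list of codes. *)
have : #|tet T'| = size (used_codes L D).
  rewrite cardE -(size_map (fun t => cell_code (name t))); apply/perm_size/uniq_perm.
  - by rewrite map_inj_uniq ?enum_uniq //; exact: inj_comp (@cell_code_inj T) name_inj.
  - exact: used_codes_uniq.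
  move=> c; apply/mapP/idP => [[t _ ->]|cS].
    by apply/mem_used_codes/used; exists t.
  have [c' ec] : exists c', c = cell_code c'.
    case: c {cS} => [[t|x]|[E [p q]]]; [exists (Old t)|exists (Infl x)|exists (Added E p q)]; done.
  move: cS; rewrite ec => /mem_used_codes/used[t <-].
  by exists t; rewrite ?mem_enum.
rewrite size_used_codes // big_split /= crossings cone_total => ->.
(* The identity with [num_branch_points] added on the left becomes the integer difference in
   [complexity]. *)
have := sum_excess_degrees linkL deg1; rewrite /complexity.
move: (\sum_(V in _) _) (num_branch_points L) (num_branches L) => K v b; lia.
Qed.
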